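(* There is an absolute constant $c>0$ such that the following holds. Let $\delta>0$, $s\in\mathbb N$ and let $f:\mathbb N\to(0,1)$ be a decreasing function. For any graph $G$ of density $p$ and any vertex equipartition $\mathcal P_0$ of order $s$, one can add/remove at most $\delta|E(G)|$ edges to obtain a graph that has an $f$-regular equipartition refining $\mathcal P_0$ of order at most $F^{(h)}(s)$, where $F(x)=2^{x/f(x)}$, $F^{(h)}$ is the $h$-fold iterate of $F$, and $h=O(\log(1/p)/\delta^2)$, i.e. $h\le c\log(1/p)/\delta^2$.
   Context: All graphs are finite and simple; the density of $G=(V,E)$ is $2|E|/|V|^2$. $d(A,B)=e(A,B)/(|A||B|)$ where $e(A,B)$ counts pairs $(u,v)\in A\times B$ with $uv\in E$. A pair $(A,B)$ is $\epsilon$-regular if $|d(A,B)-d(A',B')|\le\epsilon$ for all $A'\subseteq A$, $B'\subseteq B$ with $|A'|\ge\epsilon|A|$, $|B'|\ge\epsilon|B|$. An equipartition is a partition whose part sizes differ by at most $1$; its order is its number of parts. A vertex partition of order $k$ is $f$-regular if all pairs of distinct parts are $f(k)$-regular. *)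

(* Defs.v *)
From mathcomp Require Import all_boot.
From Stdlib Require Import Reals.

Set Implicit Arguments.
Unset Strict Implicit.
Unset Printing Implicit Defensive.

Definition simple_graph (T : finType) (e : rel T) : Prop :=
  symmetric e /\ irreflexive e.

Definition eAB (T : finType) (e : rel T) (A B : {set T}) : nat :=
  #|[set p : T * T | (p.1 \in A) && (p.2 \in B) && e p.1 p.2]|.

(* |E(G)| : each edge counted once (ordered pairs / 2). *)
Definition nedges (T : finType) (e : rel T) : R :=
  (INR (eAB e setT setT) / 2)%R.

Definition density (T : finType) (e : rel T) : R :=
  (2 * nedges e / (INR #|T| ^ 2))%R.

Definition dens (T : finType) (e : rel T) (A B : {set T}) : R :=
  (INR (eAB e A B) / (INR #|A| * INR #|B|))%R.

Definition eps_regular (T : finType) (e : rel T) (eps : R) (A B : {set T}) : Prop :=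
  forall A' B' : {set T}, A' \subset A -> B' \subset B ->
    (INR #|A'| >= eps * INR #|A|)%R -> (INR #|B'| >= eps * INR #|B|)%R ->
    (Rabs (dens e A B - dens e A' B') <= eps)%R.

Definition equipartition (T : finType) (P : {set {set T}}) : Prop :=
  partition P [set: T] /\
  (forall A B, A \in P -> B \in P -> #|A| <= #|B|.+1)%N.

Definition refines (T : finType) (P P0 : {set {set T}}) : Prop :=
  forall A, A \in P -> exists2 B, B \in P0 & A \subset B.

Definition f_regular (T : finType) (e : rel T) (f : nat -> R)
    (P : {set {set T}}) : Prop :=
  forall A B, A \in P -> B \in P -> A != B -> eps_regular e (f #|P|) A B.

Definition edit_dist (T : finType) (e e' : rel T) : R :=
  (INR #|[set p : T * T | e p.1 p.2 != e' p.1 p.2]| / 2)%R.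

(* F(x) = 2^(x/f(x)), rounded down to a natural number so that it can be
   iterated (f is only defined on naturals). *)
Definition Ffun (f : nat -> R) (x : nat) : nat :=
  Z.to_nat (Int_part (Rpower 2 (INR x / f x))).

(* Main.v *)
Require Import Defs.
From Stdlib Require Import Reals Lra Classical.
From mathcomp Require Import all_boot all_order all_algebra.
From mathcomp Require Import ring lra zify.
From mathcomp Require Import Rstruct.

(* Entropy increment. For a partition [pi] let [Ent pi] be the sum of [d ln d] over
   ordered pairs of vertices, [d] being the density of the block containing the
   pair, and let [S = p n^2] be the number of ordered edges. Then
   [- S ln (1/p) <= Ent pi <= 0]. Given [pi] of order [k], an energy increment yields
   an equitable refinement [pi'] of order exponential in a power of [k / f k] that is
   weakly regular with precision about [(f k / k)^3]. If the block densities of [pi']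
   and [pi] differ by at most [delta S / 2] in L1, then reweighting each block of [pi']
   to the density of its block in [pi] and rounding randomly yields a graph for which
   [pi] is [f k]-regular, after [delta S] changes of ordered pairs. Otherwise a
   Pinsker-type inequality gives [Ent pi' >= Ent pi + delta^2 S / 16], which can happen
   at most [16 ln (1/p) / delta^2] times. If a refinement would need more parts than
   there are vertices, the partition into singletons is regular. The remaining case,
   where [ln (1/p) / delta^2] is too small to absorb the additive constant, is that of
   a graph within [delta |E|] edges of the empty or of the complete graph. *)

Set Implicit Arguments.
Unset Strict Implicit.
Unset Printing Implicit Defensive.

(** * Growth of [Ffun] and towers of exponentials *)

Section TowerBound.
Local Open Scope R_scope.
Variable f : nat -> R.
Hypothesis f01 : forall n, 0 < f n < 1.
Hypothesis f_decr : forall m n, (m <= n)%N -> f n <= f m.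

Let ratio x := INR x / f x.

Lemma ratio_ge x : INR x <= ratio x.
Proof.
have [h0 h1] := f01 x; have hx := pos_INR x.
apply: (Rmult_le_reg_r (f x)) => //; rewrite /ratio /Rdiv Rmult_assoc Rinv_l; last Lra.lra.
by rewrite Rmult_1_r -[X in _ <= X]Rmult_1_r; apply: Rmult_le_compat_l => //; Lra.lra.
Qed.

Lemma ratio_mono m n : (m <= n)%N -> ratio m <= ratio n.
Proof.
move=> h; have [h0 h1] := f01 m; have [h2 h3] := f01 n.
apply: Rmult_le_compat; [exact: pos_INR|by apply/Rlt_le/Rinv_0_lt_compat| |].
- by apply: le_INR; apply/leP.
- by apply: Rinv_le_contravar => //; apply: f_decr.
Qed.

Lemma le_Ffun n x : INR n <= Rpower 2 (ratio x) -> (n <= Ffun f x)%N.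
Proof.
move=> h; rewrite /Ffun -/(ratio x).
have [h1 h2] := base_Int_part (Rpower 2 (ratio x)).
move: (Int_part _) h1 h2 => z h1 h2.
have : Z.lt (Z.of_nat n) (Z.succ z).
  by apply: lt_IZR; rewrite succ_IZR -INR_IZR_INZ; Lra.lra.
by move=> hz; lia.
Qed.

Lemma Ffun_le x : INR (Ffun f x) <= Rpower 2 (ratio x).
Proof.
rewrite /Ffun -/(ratio x).
have [h1 h2] := base_Int_part (Rpower 2 (ratio x)).
have h3 : 0 < Rpower 2 (ratio x) by apply: exp_pos.
move: (Int_part _) h1 h2 => z h1 h2.
have hz : Z.le Z0 z by apply/Z.lt_succ_r; apply: lt_IZR; rewrite succ_IZR; Lra.lra.
by rewrite INR_IZR_INZ (_ : Z.of_nat (Z.to_nat z) = z) //; lia.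
Qed.

Lemma Ffun_mono m n : (m <= n)%N -> (Ffun f m <= Ffun f n)%N.
Proof.
move=> h; apply: le_Ffun; apply: Rle_trans (Ffun_le m) _.
by apply: Rle_Rpower; [Lra.lra | apply: ratio_mono].
Qed.

Lemma expn2_le_Ffun x : (2 ^ x <= Ffun f x)%N.
Proof.
apply: le_Ffun.
have -> : INR (2 ^ x) = Rpower 2 (INR x).
  rewrite Rpower_pow; last Lra.lra.
  by elim: x => //= x IH; rewrite expnS mult_INR IH.
by apply: Rle_Rpower; [Lra.lra | apply: ratio_ge].
Qed.

Lemma Ffun_ge_id x : (x <= Ffun f x)%N.
Proof. by apply: leq_trans (expn2_le_Ffun x); apply: ltnW; apply: ltn_expl. Qed.

Lemma iter_Ffun_mono h m n : (m <= n)%N -> (iter h (Ffun f) m <= iter h (Ffun f) n)%N.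
Proof. by move=> hmn; elim: h => //= h; apply: Ffun_mono. Qed.

Lemma iter_Ffun_le h1 h2 x : (h1 <= h2)%N -> (iter h1 (Ffun f) x <= iter h2 (Ffun f) x)%N.
Proof.
move=> h; rewrite -(subnK h); elim: (h2 - h1)%N => // d IH.
by rewrite addSn /=; apply: leq_trans IH (Ffun_ge_id _).
Qed.

Lemma iter_expn2_le h x : (iter h (expn 2) x <= iter h (Ffun f) x)%N.
Proof.
elim: h => //= h IH; apply: leq_trans (expn2_le_Ffun _).
by rewrite leq_exp2l.
Qed.

(** An integer substitute for [k / f k]. The precision and the number of parts in each round are
    expressed through it. *)
Definition ratio_bound k := Z.to_nat (up (ratio k)).

Lemma ratio_boundP k : (0 < k)%N -> ratio k <= INR (ratio_bound k) /\
  [&& (k <= ratio_bound k)%N, (2 <= ratio_bound k)%N & (ratio_bound k <= Ffun f k)%N].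
Proof.
move=> k0; have [h1 h2] := archimed (ratio k); have hk := ratio_ge k.
have k1 : 1 <= INR k by apply: (le_INR 1); apply/leP.
have r1 : 1 <= ratio k by Lra.lra.
have hz : Z.lt (Zpos xH) (up (ratio k)) by apply: lt_IZR; Lra.lra.
have e : INR (ratio_bound k) = IZR (up (ratio k)).
  by rewrite /ratio_bound INR_IZR_INZ; congr IZR; lia.
split; first by rewrite e; Lra.lra.
apply/and3P; split.
- by apply/leP; apply: INR_le; rewrite e; Lra.lra.
- by rewrite /ratio_bound; lia.
(* [up] adds at most 1. With [ratio k = 1 + c], the claim becomes [2 + c <= 2 * 2 ^ c], which
   follows from [2 ^ c >= 1 + c * ln 2] and [ln 2 > 1/2]. *)
apply: le_Ffun; rewrite e; apply: (Rle_trans _ (ratio k + 1)); first by Lra.lra.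
have [c hc] : exists c, ratio k = 1 + c by exists (ratio k - 1); Lra.lra.
rewrite hc in r1 *; rewrite Rpower_plus Rpower_1; last Lra.lra.
have := exp_ineq1_le (c * ln 2); rewrite -/(Rpower 2 c).
have := ln_lt_2; move: (ln 2) (Rpower 2 c) => a b ha hb.
by apply: (Rle_trans _ (2 * (1 + c * a))); last Lra.lra; Lra.nra.
Qed.

(** The left side is [2 * M * l ^ N] for the parameters [l] and [N] of one round. It is at most
    [M ^ (M ^ 20) <= 2 ^ (M ^ 21)], and [M ^ 21 <= 2 ^ (2 ^ 5 * 2 ^ M)] accounts for the remaining
    four exponentials. *)
Lemma tower_bound M : (2 <= M)%N ->
  (2 * M * (2 ^ 9 * M ^ 3) ^ (2 ^ 10 * M ^ 6).+1 <= iter 5 (expn 2) M)%N.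
Proof.
move=> hM; have M0 : (0 < M)%N by apply: leq_trans hM.
pose x := (2 ^ 10 * M ^ 6)%N.
have a1 : (2 ^ 9 * M ^ 3 <= M ^ 12)%N by rewrite (expnD M 9 3) leq_mul // leq_exp2r.
have a2 : (2 * M * (2 ^ 9 * M ^ 3) ^ x.+1 <= M ^ (2 + 12 * x.+1))%N.
  rewrite expnD expnM; apply: leq_mul; first by rewrite -[(M ^ 2)%N]/(M * M)%N leq_mul.
  by rewrite leq_exp2r.
have a3 : (2 + 12 * x.+1 <= M ^ 20)%N.
  have x4 : (4 <= x)%N.
    by rewrite -[4%N]/(2 ^ 2 * 1)%N leq_mul ?leq_exp2l // expn_gt0 M0.
  apply: leq_trans (_ : 2 ^ 4 * x <= _)%N; first by rewrite -[(2 ^ 4)%N]/16%N; lia.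
  by rewrite /x mulnA -expnD (expnD M 14 6) leq_mul // leq_exp2r.
have a4 : (M ^ (M ^ 20) <= 2 ^ (M ^ 21))%N.
  rewrite (expnS M 20) expnM leq_exp2r ?expn_gt0 ?M0 //.
  by apply: ltnW; apply: ltn_expl.
have a5 : (M ^ 21 <= 2 ^ (2 ^ 5 * 2 ^ M))%N.
  apply: leq_trans (_ : (2 ^ M) ^ 21 <= _)%N.
    by rewrite leq_exp2r //; apply: ltnW; apply: ltn_expl.
  rewrite -expnM leq_exp2l // mulnC leq_mul //.
  by apply: ltnW; apply: ltn_expl.
have a6 : (2 ^ 5 * 2 ^ M <= 2 ^ (2 ^ (2 ^ M)))%N.
  rewrite -expnD leq_exp2l //.
  have b1 : (M.+1 <= 2 ^ M)%N by apply: ltn_expl.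
  apply: leq_trans (_ : 2 ^ (M.+1) <= _)%N; last by rewrite leq_exp2l.
  elim: M hM {M0 x a1 a2 a3 a4 a5 b1} => // M IH; case: (ltngtP M 1%N) => [|hM _|-> //]; first lia.
  by have := IH hM; rewrite (expnS 2 M.+1); lia.
apply: leq_trans a2 _; apply: leq_trans (_ : M ^ (M ^ 20) <= _)%N.
  by rewrite leq_exp2l.
apply: leq_trans a4 _; rewrite /= leq_exp2l //; apply: leq_trans a5 _.
by rewrite leq_exp2l.
Qed.

(** One application of [Ffun] dominates [M], and five more dominate the five exponentials; hence the
    cost of 6 iterations per round. *)
Lemma ratio_bound_tower k (M := ratio_bound k) : (0 < k)%N ->
  (2 * M * (2 ^ 9 * M ^ 3) ^ (2 ^ 10 * M ^ 6).+1 <= iter 6 (Ffun f) k)%N.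
Proof.
move=> k0; have [_ /and3P[_ h2 h3]] := ratio_boundP k0.
apply: leq_trans (tower_bound h2) _; apply: leq_trans (iter_expn2_le 5 _) _.
by rewrite [X in (_ <= X)%N]iterSr iter_Ffun_mono.
Qed.

End TowerBound.

(** * Cutting a coloured set into nearly equal pieces *)

Lemma count_index_iota (T : eqType) (s : seq T) (P : pred nat) : uniq s ->
  count (fun x => P (index x s)) s = count P (iota 0 (size s)).
Proof.
move=> us; rewrite -[RHS](@count_map _ _ (fun x => x) P) map_id.
have -> : iota 0 (size s) = [seq index x s | x <- s].
  apply: (@eq_from_nth _ 0); rewrite ?size_map ?size_iota // => i hi.
  case: s us hi => // x0 s us hi.
  by rewrite (nth_map x0) // index_uniq // nth_iota.
by rewrite count_map.
Qed.

Lemma count_interval_iota a b q : a <= b -> b <= q ->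
  count (fun j => a <= j < b) (iota 0 q) = b - a.
Proof.
move=> hab hbq; rewrite -[q](subnKC (leq_trans hab hbq)) iotaD add0n count_cat.
have -> : q - a = (b - a) + (q - b) by lia.
rewrite iotaD count_cat subnKC // addnA.
have -> : count (fun j => a <= j < b) (iota 0 a) = 0.
  by apply/eqP; rewrite -leqn0 leqNgt -has_count; apply/hasP => -[j]; rewrite mem_iota; lia.
have -> : count (fun j => a <= j < b) (iota b (q - b)) = 0.
  by apply/eqP; rewrite -leqn0 leqNgt -has_count; apply/hasP => -[j]; rewrite mem_iota; lia.
rewrite addn0 add0n -[RHS](size_iota a); apply/eqP; rewrite -all_count.
by apply/allP => j; rewrite mem_iota subnKC.
Qed.

Section ChopSet.
Variables (T : finType) (col : T -> nat) (l : nat) (A : {set T}).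
Hypothesis l_gt0 : 0 < l.

(* [A] is listed in order of colour and cut into [l] consecutive pieces, so a
   piece that is not monochromatic contains the first element of some colour. *)
Definition color_list := sort (relpre col leq) (enum A).
(** The formula is chosen so that piece [r] occupies exactly the positions from [(r * #|A|) %/ l] up
    to, but excluding, [(r.+1 * #|A|) %/ l]. *)
Definition piece_at j := (j.+1 * l).-1 %/ #|A|.
Definition piece x := piece_at (index x color_list).
(** If no element has colour at least [j], [find] returns the length [#|A|]; for nonempty [A] its
    [piece_at] is at least [l], so it names an empty piece. *)
Definition mixed_pieces d :=
  [seq piece_at (find (fun z => j <= col z) color_list) | j <- iota 1 d].

Let size_cl : size color_list = #|A|.
Proof. by rewrite size_sort cardE. Qed.

Let uniq_cl : uniq color_list.
Proof. by rewrite sort_uniq enum_uniq. Qed.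

Let mem_cl x : (x \in color_list) = (x \in A).
Proof. by rewrite mem_sort mem_enum. Qed.

Hypothesis A_gt0 : 0 < #|A|.

Let piece_at_lt j : j < #|A| -> piece_at j < l.
Proof. by move=> h; rewrite /piece_at ltn_divLR //; nia. Qed.

Let piece_at_eq r j : (piece_at j == r) =
  ((r * #|A|) %/ l <= j < (r.+1 * #|A|) %/ l).
Proof.
rewrite eqn_leq andbC; congr (_ && _).
  by rewrite /piece_at leq_divRL // -[RHS]ltnS ltn_divLR // ; nia.
by rewrite -[LHS]ltnS [RHS]leq_divRL // /piece_at ltn_divLR //; nia.
Qed.

Let piece_at_mono i j : i <= j -> piece_at i <= piece_at j.
Proof. by move=> h; apply: leq_div2r; nia. Qed.

Lemma piece_lt x : x \in A -> piece x < l.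
Proof. by move=> hx; apply: piece_at_lt; rewrite -size_cl index_mem mem_cl. Qed.

(** A piece is an interval between two floors of consecutive multiples of [#|A| / l], a quotient
    between [a] and [a + 1]. The upper bound is not strict because a class of size [m.+1] may be
    divisible by [l] when [a = m %/ l]. *)
Lemma card_piece a r : a * l <= #|A| <= a * l + l -> r < l ->
  a <= #|[set x in A | piece x == r]| <= a.+1.
Proof.
move=> /andP[h1 h2] hr.
have -> : #|[set x in A | piece x == r]| = (r.+1 * #|A|) %/ l - (r * #|A|) %/ l.
  have -> : #|[set x in A | piece x == r]| = count (fun x => piece x == r) color_list.
    rewrite (permP (permEl (perm_sort _ _))) -size_filter cardE; apply/perm_size/uniq_perm.
    - exact: enum_uniq.
    - by rewrite filter_uniq ?enum_uniq.
    by move=> x; rewrite mem_filter !mem_enum inE andbC.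
  rewrite (@count_index_iota _ _ (fun j => piece_at j == r)) // size_cl.
  rewrite (eq_count (piece_at_eq r)) count_interval_iota //.
    by rewrite leq_div2r // leq_mul.
  by apply: leq_trans (leq_div2r l (leq_mul hr (leqnn _))) _; rewrite mulKn.
have [b hb] : exists b, #|A| = a * l + b by exists (#|A| - a * l); lia.
have -> : r.+1 * #|A| = a * l + (r * #|A| + b) by rewrite mulSn {1}hb; lia.
rewrite divnMDl //.
have hb2 : b <= l by lia.
have : (r * #|A|) %/ l <= (r * #|A| + b) %/ l by apply: leq_div2r; lia.
have : (r * #|A| + b) %/ l <= ((r * #|A|) %/ l).+1.
  apply: leq_trans (_ : (r * #|A| + l) %/ l <= _); first by apply: leq_div2r; lia.
  by rewrite divnDr ?dvdnn // divnn l_gt0 addn1.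
lia.
Qed.

(** If [col x < col y], the first element of colour at least [col y] comes after [x] and not after
    [y], hence lies in their common piece, which is therefore mixed. *)
Lemma piece_mono d x y : (forall z, col z <= d) -> x \in A -> y \in A ->
  piece x = piece y -> piece x \notin mixed_pieces d -> col x = col y.
Proof.
move=> hd.
wlog hxy : x y / col x < col y.
  move=> hw hx hy e hn; case: (ltngtP (col x) (col y)) => // h.
    by have := hw _ _ h hx hy e hn; lia.
  by rewrite e in hn; have := hw _ _ h hy hx (esym e) hn; lia.
move=> hx hy e /negP[]; apply/mapP; exists (col y).
  by rewrite mem_iota add1n ltnS hd; lia.
set P := fun z => _; have hP : has P color_list.
  by apply/hasP; exists y; rewrite ?mem_cl ?/P.
have h1 : find P color_list <= index y color_list.
  rewrite leqNgt; apply/negP => /(before_find y).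
  by rewrite nth_index ?mem_cl // /P leqnn.
have h2 : index x color_list < find P color_list.
  rewrite ltnNge; apply/negP => h.
  have tr : transitive (relpre col leq) by move=> a b c; apply: leq_trans.
  have rf : reflexive (relpre col leq) by move=> a; apply: leqnn.
  have so : sorted (relpre col leq) color_list.
    by apply: sort_sorted => a b; apply: leq_total.
  have := sorted_leq_nth tr rf x so (find P color_list) (index x color_list).
  rewrite !inE -has_find hP index_mem mem_cl => /(_ isT hx h).
  rewrite nth_index ?mem_cl //=; have := nth_find x hP; rewrite /P; lia.
apply/eqP; rewrite eqn_leq /piece piece_at_mono; last exact: ltnW.
by rewrite -/(piece x) e piece_at_mono.
Qed.

Lemma card_mixed a d : a * l <= #|A| <= a * l + l ->
  #|[set x in A | piece x \in mixed_pieces d]| <= d * a.+1.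
Proof.
move=> ha; have -> : d = size (mixed_pieces d) by rewrite size_map size_iota.
rewrite {1}size_map size_iota.
elim: (mixed_pieces d) => [|r s IH].
  by rewrite leqn0 cards_eq0; apply/eqP/setP => x; rewrite !inE andbF.
have -> : [set x in A | piece x \in r :: s] =
    [set x in A | piece x == r] :|: [set x in A | piece x \in s].
  by apply/setP => x; rewrite !inE andb_orr.
apply: (leq_trans (leq_card_setU _ _)); rewrite mulSn leq_add //.
case: (ltnP r l) => hr; first by have /andP[] := card_piece ha hr.
rewrite (_ : [set _ in _ | _] = set0) ?cards0 //.
apply/setP => x; rewrite !inE; apply/negP => /andP[/piece_lt hx /eqP e]; lia.
Qed.

End ChopSet.


Import Order.TTheory GRing.Theory Num.Theory.
Local Open Scope ring_scope.
(* Otherwise arguments of type [R] are read in [R_scope], with Stdlib's operations. *)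
Local Arguments exp : clear scopes.
Local Arguments ln : clear scopes.
Bind Scope ring_scope with R.

(** * Averaging over blocks as conditional expectation *)

Section BlockAverage.
Variables (F : realFieldType) (X : finType).
Implicit Types (L : eqType) (g t : X -> F).

Definition blockmean L (rho : X -> L) g x : F :=
  (\sum_(y | rho y == rho x) g y) / #|[pred y | rho y == rho x]|%:R.

Definition blockwise L (rho : X -> L) t := forall x y, rho x = rho y -> t x = t y.

Definition finer (L L' : eqType) (rho' : X -> L') (rho : X -> L) :=
  forall x y, rho' x = rho' y -> rho x = rho y.

Lemma finer_refl L (rho : X -> L) : finer rho rho.
Proof. by []. Qed.

Lemma finer_trans (L1 L2 L3 : eqType) (r1 : X -> L1) (r2 : X -> L2) (r3 : X -> L3) :
  finer r1 r2 -> finer r2 r3 -> finer r1 r3.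
Proof. by move=> h h' x y /h /h'. Qed.

Lemma blockwise_finer (L L' : eqType) (rho' : X -> L') (rho : X -> L) t :
  finer rho' rho -> blockwise rho t -> blockwise rho' t.
Proof. by move=> h ht x y /h /ht. Qed.

Lemma block_card_gt0 L (rho : X -> L) x : (0 < #|[pred y | rho y == rho x]|)%N.
Proof. by apply/card_gt0P; exists x; rewrite inE. Qed.

Lemma blockmean_blockwise L (rho : X -> L) g : blockwise rho (blockmean rho g).
Proof. by move=> x y e; rewrite /blockmean e. Qed.

(** After exchanging the sums, each [y] is counted once for every element of its block, which
    cancels the normalisation. *)
Lemma blockmean_proj L (rho : X -> L) g t : blockwise rho t ->
  \sum_x blockmean rho g x * t x = \sum_x g x * t x.
Proof.
move=> ht.
transitivity (\sum_x \sum_(y | rho y == rho x)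
    g y * t y / #|[pred z | rho z == rho y]|%:R).
  apply: eq_bigr => x _; rewrite /blockmean mulrAC big_distrl /= mulr_suml.
  by apply: eq_bigr => y /eqP e; rewrite e (ht _ _ e).
rewrite (exchange_big_dep predT) //=; apply: eq_bigr => y _.
rewrite sumr_const -[LHS]mulr_natr.
have -> : #|[pred i | rho y == rho i]| = #|[pred z | rho z == rho y]|.
  by apply: eq_card => z; rewrite !inE eq_sym.
by rewrite divfK // pnatr_eq0 -lt0n block_card_gt0.
Qed.

Lemma blockmean_ge0 L (rho : X -> L) g x :
  (forall y, 0 <= g y) -> 0 <= blockmean rho g x.
Proof. by move=> h; rewrite divr_ge0 ?ler0n ?sumr_ge0. Qed.

Lemma blockmean_le1 L (rho : X -> L) g x :
  (forall y, g y <= 1) -> blockmean rho g x <= 1.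
Proof.
move=> h; rewrite ler_pdivrMr ?ltr0n ?block_card_gt0 // mul1r.
apply: (le_trans (ler_sum _ (fun y _ => h y))).
by rewrite sumr_const lexx.
Qed.

Lemma blockmean_diff (L L' : eqType) (rho' : X -> L') (rho : X -> L) g t :
  finer rho' rho -> blockwise rho t ->
  \sum_x (blockmean rho' g x - blockmean rho g x) * t x = 0.
Proof.
move=> h ht; under eq_bigr do rewrite mulrBl.
by rewrite sumrB !blockmean_proj ?subrr //; apply: blockwise_finer ht.
Qed.

(** Pythagoras: the increment between the two averages is orthogonal to every [rho]-blockwise
    function, in particular to the coarser average. *)
Lemma blockmean_energy (L L' : eqType) (rho' : X -> L') (rho : X -> L) g :
  finer rho' rho ->
  \sum_x blockmean rho' g x ^+ 2 =
  \sum_x blockmean rho g x ^+ 2 + \sum_x (blockmean rho' g x - blockmean rho g x) ^+ 2.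
Proof.
move=> h; have e := blockmean_diff g h (@blockmean_blockwise _ rho g).
rewrite -[RHS]addr0 -[X in _ + X](mulr0 2) -[X in 2 * X]e mulr_sumr -!big_split /=.
by apply: eq_bigr => x _; ring.
Qed.

(** Testing the increment against the indicator of the blocks of mean zero gives a vanishing sum of
    nonnegative terms. This is the absolute continuity that the divergence estimates require. *)
Lemma blockmean_eq0 (L L' : eqType) (rho' : X -> L') (rho : X -> L) g x :
  finer rho' rho -> (forall y, 0 <= g y) ->
  blockmean rho g x = 0 -> blockmean rho' g x = 0.
Proof.
move=> h g0 e.
have ht : blockwise rho (fun y => (blockmean rho g y == 0)%:R : F).
  by move=> y z /(@blockmean_blockwise _ rho g) ->.
have := blockmean_diff g h ht; under eq_bigr => y _.
  rewrite (_ : _ * _ = blockmean rho' g y * (blockmean rho g y == 0)%:R).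
    over.
  by case: eqP => [->|_]; rewrite ?subr0 ?mulr0.
move=> /psumr_eq0P /(_ x isT) ; rewrite e eqxx mulr1; apply => y _.
by rewrite mulr_ge0 ?ler0n ?blockmean_ge0.
Qed.

(* From [0 <= (D - c t)^2], summed over [X]. *)
Lemma sumsq_of_correlation (D t : X -> F) (c : F) : 0 <= c ->
  (forall x, `|t x| <= 1) -> c * #|X|%:R <= \sum_x D x * t x ->
  c ^+ 2 * #|X|%:R <= \sum_x D x ^+ 2.
Proof.
move=> c0 ht hc.
have h : 0 <= \sum_x (D x - c * t x) ^+ 2 by apply: sumr_ge0 => x _; apply: sqr_ge0.
have e : \sum_x (D x - c * t x) ^+ 2 =
   \sum_x D x ^+ 2 - 2 * c * (\sum_x D x * t x) + c ^+ 2 * \sum_x t x ^+ 2.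
  by rewrite !mulr_sumr -sumrB -big_split /=; apply: eq_bigr => x _; ring.
have ht2 : \sum_x t x ^+ 2 <= #|X|%:R.
  rewrite -sum1_card natr_sum; apply: ler_sum => x _.
  by rewrite -real_normK ?num_real // exprn_ile1.
have := ler_wpM2l (sqr_ge0 c) ht2; have := ler_wpM2l c0 hc; move: h; rewrite e => h; nra.
Qed.

End BlockAverage.

(** * Equitable labellings and their refinements *)

Section Equilabel.
Local Open Scope nat_scope.
Variable T : finType.
Implicit Types (pi : T -> nat).

Definition equilabel k m pi := (forall x, pi x < k) /\
  (forall i, i < k -> m <= #|[set x | pi x == i]| <= m.+1).

Lemma card_by_label k pi (A : {set T}) : (forall x, pi x < k) ->
  #|A| = \sum_(i < k) #|[set x in A | pi x == i]|.
Proof.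
move=> h; rewrite -sum1_card (partition_big (fun x => Ordinal (h x)) predT) //=.
apply: eq_bigr => i _; rewrite -sum1_card; apply: eq_bigl => x.
by rewrite !inE -val_eqE.
Qed.

Lemma equilabel_card k m pi : equilabel k m pi -> k * m <= #|T| <= k * m.+1.
Proof.
move=> [h1 h2]; rewrite -cardsT (card_by_label _ h1).
have e (i : 'I_k) : [set x in [set: T] | pi x == i] = [set x | pi x == i].
  by apply/setP => x; rewrite !inE.
apply/andP; split.
  rewrite -[k in k * _]card_ord -sum_nat_const; apply: leq_sum => i _.
  by rewrite e; have /andP[] := h2 i (ltn_ord i).
rewrite -[k in _ <= k * _]card_ord -sum_nat_const; apply: leq_sum => i _.
by rewrite e; have /andP[] := h2 i (ltn_ord i).
Qed.

(** Every class is cut into [l] pieces along the colouring, and [Bad] is the union of the mixed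
    pieces. With [a = m %/ l >= 1], a class loses at most [d * a.+1 <= 2 * d * a] elements, while it
    has at least [a * l]. *)
Lemma equilabel_chop k m pi (col : T -> nat) d l :
  equilabel k m pi -> (forall x, col x <= d) -> 0 < l <= m ->
  exists pi' (Bad : {set T}), equilabel (k * l) (m %/ l) pi' /\ finer pi' pi /\
    (forall x y, pi' x = pi' y -> (x \in Bad) = (y \in Bad)) /\
    (forall x y, pi' x = pi' y -> x \notin Bad -> col x = col y) /\
    #|Bad| * l <= d.*2 * #|T|.
Proof.
move=> eq hcol /andP[l0 lm]; have [h1 h2] := eq.
pose C x := [set y | pi y == pi x].
pose p x := piece col l (C x) x.
(* Quotient and remainder by [l] recover the old class and the piece. *)
pose pi' x := pi x * l + p x.
have xC x : x \in C x by rewrite inE.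
have C0 x : 0 < #|C x| by apply/card_gt0P; exists x.
have pl x : p x < l by apply: piece_lt.
have pi'E x y : pi' x = pi' y -> pi x = pi y /\ p x = p y.
  move=> e; have ex z : pi' z %/ l = pi z by rewrite divnMDl // divn_small ?addn0.
  have e1 : pi x = pi y by rewrite -ex e ex.
  by split=> //; move: e; rewrite /pi' e1 => /addnI.
have Ceq x y : pi x = pi y -> C x = C y by move=> e; rewrite /C e.
have Csz i : i < k -> (m %/ l) * l <= #|[set x | pi x == i]| <= (m %/ l) * l + l.
  move=> /h2 /andP[a b]; have := leq_divM m l; have := ltn_ceil m l0; lia.
pose Bad := [set x | p x \in mixed_pieces col l (C x) d].
exists pi', Bad; split; [split|split; [|split; [|split]]].
- by move=> x; rewrite /pi'; have := h1 x; have := pl x; nia.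
- move=> i hi; have ik : i %/ l < k by rewrite ltn_divLR.
  have A0 : 0 < #|[set x | pi x == i %/ l]| by have /andP[] := h2 _ ik; lia.
  have -> : [set x | pi' x == i] = [set x in [set x | pi x == i %/ l]
       | piece col l [set x | pi x == i %/ l] x == i %% l].
    apply/setP => x; rewrite !inE; apply/eqP/andP.
      move=> <-; rewrite /pi' divnMDl // (divn_small (pl x)) addn0 eqxx; split=> //.
      by rewrite modnMDl modn_small.
    by case=> /eqP e1 /eqP e2; rewrite /pi' /p /C e1 e2 -divn_eq.
  by apply: card_piece; rewrite ?Csz ?ltn_mod.
- by move=> x y /pi'E[].
- by move=> x y /pi'E[e1 e2]; rewrite !inE e2 (Ceq _ _ e1).
- move=> x y /pi'E[e1 e2]; rewrite inE => hb.
  apply: (@piece_mono _ col l (C x)) hb => //; first by rewrite inE e1.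
  by rewrite -/(p x) e2 /p -(Ceq _ _ e1).
rewrite (card_by_label _ h1) big_distrl /= -cardsT (card_by_label setT h1) big_distrr /=.
apply: leq_sum => i _.
have A0 : 0 < #|[set x | pi x == i]| by have /andP[] := h2 _ (ltn_ord i); lia.
have -> : [set x in Bad | pi x == i] = [set x in [set x | pi x == i]
       | piece col l [set x | pi x == i] x \in mixed_pieces col l [set x | pi x == i] d].
  apply/setP => x; rewrite !inE andbC; case: eqP => //= e.
  by rewrite /p /C e.
have -> : [set x in [set: T] | pi x == i] = [set x | pi x == i].
  by apply/setP => x; rewrite !inE.
have := @card_mixed T col l _ l0 A0 _ d (Csz _ (ltn_ord i)).
have /andP[c1 c2] := Csz _ (ltn_ord i).
have : 0 < m %/ l by rewrite divn_gt0.
move: (m %/ l) c1 c2 => a c1 c2 a0 hm.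
have : #|[set x in [set x | pi x == i]
       | piece col l [set x | pi x == i] x \in mixed_pieces col l [set x | pi x == i] d]| * l
  <= d * a.+1 * l by rewrite leq_mul.
move=> h; apply: (leq_trans h); rewrite -muln2 -!mulnA leq_mul //; nia.
Qed.

End Equilabel.

(** * Weak regularity by energy increment *)

Section WeakRegularity.
Variables (F : realFieldType) (T : finType) (G : T * T -> F).
Hypothesis G01 : forall p, 0 <= G p <= 1.
Implicit Types (pi : T -> nat) (eps : F).

Definition pairlabel pi (p : T * T) := (pi p.1, pi p.2).

Lemma pairlabel_finer pi' pi : finer pi' pi -> finer (pairlabel pi') (pairlabel pi).
Proof. by move=> h [x y] [x' y'] [/h e1 /h e2]; rewrite /pairlabel /= e1 e2. Qed.

Definition pairmean pi := blockmean (pairlabel pi) G.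

Lemma pairmean01 pi p : 0 <= pairmean pi p <= 1.
Proof.
by rewrite blockmean_ge0 ?blockmean_le1 // => q; case/andP: (G01 q).
Qed.

Lemma card_pairs : #|{: T * T}|%:R = #|T|%:R ^+ 2 :> F.
Proof. by rewrite card_prod natrM expr2. Qed.

(* The block-constant multiplier [sg] makes this stronger than a cut-norm bound:
   the discrepancies of the blocks may not cancel each other. *)
Definition weakly_regular eps pi :=
  forall (S U : {set T}) (sg : T * T -> F), blockwise (pairlabel pi) sg ->
  (forall p, `|sg p| <= 1) ->
  \sum_(p | (p.1 \in S) && (p.2 \in U)) sg p * (G p - pairmean pi p)
    <= eps * #|T|%:R ^+ 2.

(** A violating triple [S], [U], [sg] is a test correlating with [G - pairmean pi]. Refining [pi]
    along [S] and [U] makes the test blockwise up to few pairs, so it correlates with the increment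
    of the averages, whose squared norm is the energy gain. *)
Lemma energy_increment eps k m l pi :
  equilabel k m pi -> 0 < eps -> (0 < l <= m)%N -> 24 <= eps * l%:R ->
  ~ weakly_regular eps pi ->
  exists pi', equilabel (k * l) (m %/ l) pi' /\ finer pi' pi /\
    \sum_p pairmean pi p ^+ 2 + (eps / 2) ^+ 2 * #|T|%:R ^+ 2
      <= \sum_p pairmean pi' p ^+ 2.
Proof.
move=> eq e0 lm hl hn; apply: NNPP => hno; apply: hn => S U sg hsg sg1.
rewrite leNgt; apply/negP => hgt; apply: hno.
(* Four colours, one for each pattern of membership in [S] and [U]. *)
pose col x := ((x \in S).*2 + (x \in U))%N.
have hcol x : (col x <= 3)%N by rewrite /col; case: (x \in S); case: (x \in U).
have [pi' [Bad [eq' [fin [hB [hmono hc]]]]]] := equilabel_chop eq hcol lm.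
exists pi'; split=> //; split=> //.
have fin2 := pairlabel_finer fin.
rewrite [leRHS](blockmean_energy G fin2) lerD2l -card_pairs.
(* Classes of [pi'] outside [Bad] are monochromatic, and [Bad] is a union of classes, so this
   predicate is constant on blocks of [pi']. *)
pose good p := [&& p.1 \in S, p.2 \in U, p.1 \notin Bad & p.2 \notin Bad].
pose t p := if good p then sg p else 0.
have ht : blockwise (pairlabel pi') t.
  move=> [x y] [x' y'] [ex ey]; rewrite /t.
  have -> : good (x, y) = good (x', y').
    rewrite /good /= -(hB _ _ ex) -(hB _ _ ey).
    case hx : (x \in Bad); first by rewrite !andbF.
    case hy : (y \in Bad); first by rewrite !andbF.
    have := hmono _ _ ex (negbT hx); have := hmono _ _ ey (negbT hy).
    rewrite /col.
    by case: (x \in S) (x \in U) (y \in S) (y \in U) (x' \in S) (x' \in U)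
         (y' \in S) (y' \in U) => [] [] [] [] [] [] [] [].
  case: ifP => // _; apply: hsg; apply: fin2; by rewrite /pairlabel /= ex ey.
have t1 p : `|t p| <= 1 by rewrite /t; case: ifP => // _; rewrite normr0 ler01.
apply: (sumsq_of_correlation _ t1); first by lra.
have -> : \sum_p (blockmean (pairlabel pi') G p - blockmean (pairlabel pi) G p) * t p
   = \sum_p (G p - pairmean pi p) * t p.
  under eq_bigr do rewrite mulrBl.
  rewrite sumrB blockmean_proj // -sumrB.
  by apply: eq_bigr => p _; rewrite -mulrBl.
(* Here [#|Bad| * l <= 6 * #|T|], so at most [12 * #|T| ^ 2 / l] pairs are discarded;
   [24 <= eps * l] makes this half of the correlation. *)
have hbad : \sum_(p : T * T | (p.1 \in Bad) || (p.2 \in Bad)) (1 : F) <= eps / 2 * #|T|%:R ^+ 2.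
  have : \sum_(p : T * T | (p.1 \in Bad) || (p.2 \in Bad)) (1 : F) <=
     2 * (#|Bad|%:R * #|T|%:R).
    have -> : 2 * (#|Bad|%:R * #|T|%:R) = (2 * (#|Bad| * #|T|))%:R :> F.
      by rewrite !natrM.
    rewrite sumr_const ler_nat mul2n -addnn.
    have -> : (#|Bad| * #|T| + #|Bad| * #|T| = #|setX Bad [set: T]| + #|setX [set: T] Bad|)%N.
      by rewrite !cardsX cardsT mulnC.
    apply: leq_trans (leq_card_setU _ _); apply: subset_leq_card; apply/subsetP => p.
    by rewrite !inE andbT.
  have hcF : #|Bad|%:R * l%:R <= 6 * #|T|%:R :> F by rewrite -!natrM ler_nat.
  have l0 : 0 < l%:R :> F by rewrite ltr0n; case/andP: lm.
  have n0 : 0 <= #|T|%:R :> F by [].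
  have b0 : 0 <= #|Bad|%:R :> F by [].
  move=> h; apply: (le_trans h); rewrite -(ler_pM2r l0).
  move: hcF hl n0 b0 l0; move: #|T|%:R #|Bad|%:R l%:R => n b L hcF hl n0 b0 l0.
  have := ler_wpM2r n0 hcF; have := ler_wpM2r (mulr_ge0 n0 n0) hl; nra.
have key : \sum_(p | (p.1 \in S) && (p.2 \in U)) sg p * (G p - pairmean pi p)
  <= \sum_p (G p - pairmean pi p) * t p +
     \sum_(p : T * T | (p.1 \in Bad) || (p.2 \in Bad)) 1.
  rewrite [X in X <= _]big_mkcond [X in _ + X]big_mkcond -big_split /=.
  apply: ler_sum => p _; rewrite /t /good.
  have /andP[a1 a2] := G01 p; have /andP[b1 b2] := pairmean01 pi p.
  have c1 : `|sg p * (G p - pairmean pi p)| <= 1.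
    rewrite normrM -[1]mulr1 ler_pM //; rewrite ler_norml; apply/andP; split; lra.
  have := ler_norm (sg p * (G p - pairmean pi p)).
  case: (p.1 \in S) => /=; last by rewrite mulr0 add0r; case: ifP.
  case: (p.2 \in U) => /=; last by rewrite mulr0 add0r; case: ifP.
  by case: (p.1 \in Bad); case: (p.2 \in Bad) => /=; rewrite ?mulr0; lra.
rewrite card_pairs; lra.
Qed.

Lemma weak_regularity_or_energy eps l N k m pi :
  equilabel k m pi -> 0 < eps -> 24 <= eps * l%:R -> (0 < k)%N ->
  (2 * k * l ^ N <= #|T|)%N ->
  exists j m' pi', [/\ (j <= N)%N, equilabel (k * l ^ j) m' pi', finer pi' pi &
    weakly_regular eps pi' \/
    \sum_p pairmean pi p ^+ 2 + N%:R * ((eps / 2) ^+ 2 * #|T|%:R ^+ 2)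
      <= \sum_p pairmean pi' p ^+ 2].
Proof.
move=> eq e0 hl; elim: N k m pi eq => [|N IH] k m pi eq k0 hn.
  by exists 0%N, m, pi; rewrite muln1; split=> //; right; rewrite mul0r addr0.
have l0 : (0 < l)%N by case: (l) hl => //; rewrite mulr0; lra.
case: (classic (weakly_regular eps pi)) => hw.
  by exists 0%N, m, pi; rewrite muln1; split=> //; left.
(* The classes are still large enough to be cut: [k * m.+1 >= #|T| >= 2 * k * l] gives
   [m.+1 >= 2 * l]. *)
have lm : (0 < l <= m)%N.
  rewrite l0 /=; have /andP[_] := equilabel_card eq => h.
  have hp : (0 < l ^ N)%N by rewrite expn_gt0 l0.
  have : (2 * k * l <= k * m.+1)%N.
    apply: leq_trans h; apply: leq_trans hn; rewrite expnS; nia.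
  rewrite [(2 * k)%N]mulnC -mulnA leq_pmul2l //; lia.
have [pi1 [eq1 [f1 h1]]] := energy_increment eq e0 lm hl hw.
have k1 : (0 < k * l)%N by rewrite muln_gt0 k0.
have hn1 : (2 * (k * l) * l ^ N <= #|T|)%N.
  by apply: leq_trans hn; rewrite expnS; apply/eq_leq; ring.
have [j [m' [pi' [hj eq' f' h']]]] := IH _ _ _ eq1 k1 hn1.
exists j.+1, m', pi'; split=> //.
- by rewrite expnS mulnA.
- exact: finer_trans f' f1.
- case: h' => h'; first by left.
  by right; move: h1 h'; rewrite -natr1; lra.
Qed.

(** The energy lies between 0 and [#|T| ^ 2], while [N] increments would add [N * (eps / 2) ^ 2 > 1]
    times [#|T| ^ 2]. *)
Lemma weak_regularity eps l N k m pi :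
  equilabel k m pi -> 0 < eps -> 24 <= eps * l%:R -> (0 < k)%N ->
  (2 * k * l ^ N <= #|T|)%N -> 4 < N%:R * eps ^+ 2 ->
  exists j m' pi', [/\ (j <= N)%N, equilabel (k * l ^ j) m' pi', finer pi' pi &
    weakly_regular eps pi'].
Proof.
move=> eq e0 hl k0 hn hN.
have [j [m' [pi' [hj eq' f' [h|h]]]]] := weak_regularity_or_energy eq e0 hl k0 hn.
  by exists j, m', pi'.
have l0 : (0 < l)%N by case: (l) hl => //; rewrite mulr0; lra.
have n0 : 0 < #|T|%:R ^+ 2 :> F.
  rewrite exprn_gt0 // ltr0n; apply: leq_trans hn; rewrite !muln_gt0 k0 expn_gt0 l0 //.
have a1 : 0 <= \sum_p pairmean pi p ^+ 2 by apply: sumr_ge0 => p _; apply: sqr_ge0.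
have a2 : \sum_p pairmean pi' p ^+ 2 <= #|T|%:R ^+ 2.
  rewrite -card_pairs -sum1_card natr_sum; apply: ler_sum => p _.
  by have /andP[? ?] := pairmean01 pi' p; rewrite exprn_ile1.
exfalso; move: h a1 a2 n0 hN; move: (#|T|%:R ^+ 2) => n2; move: (N%:R) => NN.
move: (\sum_p _) (\sum_p _) => a b; nra.
Qed.

End WeakRegularity.

(** * Independent random rounding *)

Section Rounding.
Variables (F : realFieldType) (I : finType) (w : I -> F).
Hypothesis w01 : forall i, 0 <= w i <= 1.

(** The probability of the outcome [h] of independent coins with biases [w i]; expectations are
    finite sums with these weights. *)
Definition bernoulli_weight (h : {ffun I -> bool}) : F :=
  \prod_i (if h i then w i else 1 - w i).

Lemma bernoulli_weight_ge0 h : 0 <= bernoulli_weight h.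
Proof.
by apply: prodr_ge0 => i _; have /andP[? ?] := w01 i; case: (h i) => //; rewrite subr_ge0.
Qed.

Lemma expect_prod (phi : I -> bool -> F) :
  \sum_h bernoulli_weight h * \prod_i phi i (h i) =
  \prod_i (w i * phi i true + (1 - w i) * phi i false).
Proof.
rewrite (eq_bigr (fun i => \sum_b (if b then w i else 1 - w i) * phi i b)).
  by rewrite bigA_distr_bigA; apply: eq_bigr => h _; rewrite -big_split.
by move=> i _; rewrite big_bool.
Qed.

Lemma expect1 : \sum_h bernoulli_weight h = 1.
Proof.
transitivity (\sum_h bernoulli_weight h * \prod_(i : I) 1).
  by apply: eq_bigr => h _; rewrite big1 ?mulr1.
by rewrite (expect_prod (fun _ _ => 1)) big1 // => i _; rewrite !mulr1 addrC subrK.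
Qed.

Lemma expect_pick i (phi : bool -> F) :
  \sum_h bernoulli_weight h * phi (h i) = w i * phi true + (1 - w i) * phi false.
Proof.
pose psi j b := if j == i then phi b else 1.
transitivity (\sum_h bernoulli_weight h * \prod_j psi j (h j)).
  apply: eq_bigr => h _; rewrite (bigD1 i) //= /psi eqxx big1 ?mulr1 //.
  by move=> j /negbTE ->.
rewrite expect_prod (bigD1 i) //= /psi eqxx big1 ?mulr1 // => j /negbTE ->.
by rewrite !mulr1 addrC subrK.
Qed.

Lemma exists_le_expect (Psi : {ffun I -> bool} -> F) c :
  \sum_h bernoulli_weight h * Psi h <= c -> exists h, Psi h <= c.
Proof.
move=> hc; apply: NNPP => hno.
have hgt h : c < Psi h by rewrite ltNge; apply/negP => hh; apply: hno; exists h.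
have : \sum_h bernoulli_weight h * (Psi h - c) <= 0.
  under eq_bigr do rewrite mulrBr.
  by rewrite sumrB -mulr_suml expect1 mul1r subr_le0.
have h0 h : true -> 0 <= bernoulli_weight h * (Psi h - c).
  by move=> _; rewrite mulr_ge0 ?bernoulli_weight_ge0 // subr_ge0 ltW.
move=> hle; have /psumr_eq0P e : \sum_h bernoulli_weight h * (Psi h - c) = 0.
  by apply/eqP; rewrite eq_le hle sumr_ge0.
have : \sum_h bernoulli_weight h = 0.
  apply: big1 => h _; have /eqP := e h0 h isT; rewrite mulf_eq0 => /orP[/eqP //|].
  by rewrite gt_eqF // subr_gt0.
by rewrite expect1 => /eqP; rewrite oner_eq0.
Qed.

(* Each product has expectation 1, so the tests and the number of changes can be
   controlled simultaneously by a first-moment argument. *)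
Lemma exists_rounding (J : finType) (t : J -> I -> F) (c : I -> F) (g : I -> bool)
    (B lam : F) :
  (0 < #|J|)%N -> (forall j i, `|t j i| <= 1) -> (forall i, 0 <= c i) ->
  \sum_i c i * `|(g i)%:R - w i| <= B -> 0 < B -> 0 <= lam <= 1 / 2 ->
  exists h : {ffun I -> bool},
    (forall j, \prod_i (1 + lam * (t j i * ((h i)%:R - w i))) <= 2 * #|J|%:R) /\
    \sum_i c i * (h i != g i)%:R <= 2 * B.
Proof.
move=> J0 t1 c0 hB B0 /andP[l0 l1].
pose P j (h : {ffun I -> bool}) := \prod_i (1 + lam * (t j i * ((h i)%:R - w i))).
pose E (h : {ffun I -> bool}) := \sum_i c i * (h i != g i)%:R.
have P0 j h : 0 <= P j h.
  apply: prodr_ge0 => i _; have /andP[a1 a2] := w01 i.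
  have : `|lam * (t j i * ((h i)%:R - w i))| <= 1.
    rewrite normrM -[1]mulr1 ler_pM // ?(ger0_norm l0); first lra.
    rewrite normrM -[1]mulr1 ler_pM // ler_norml.
    by case: (h i) => /=; apply/andP; split; lra.
  rewrite ler_norml => /andP[]; lra.
have E0 h : 0 <= E h by apply: sumr_ge0 => i _; rewrite mulr_ge0.
have J0' : 0 < #|J|%:R :> F by rewrite ltr0n.
have EP j : \sum_h bernoulli_weight h * P j h = 1.
  have := expect_prod (fun i b => 1 + lam * (t j i * (b%:R - w i))).
  by rewrite /P => ->; apply: big1 => i _; rewrite /=; ring.
have EE : \sum_h bernoulli_weight h * E h <= B.
  apply: le_trans hB; rewrite le_eqVlt; apply/orP; left; apply/eqP.
  under eq_bigr do rewrite mulr_sumr.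
  rewrite exchange_big; apply: eq_bigr => i _ /=.
  have := expect_pick i (fun b => c i * (b != g i)%:R) => /= ->.
  have /andP[a1 a2] := w01 i; case: (g i) => /=.
    by rewrite ger0_norm ?subr_ge0 //; ring.
  by rewrite sub0r normrN ger0_norm //; ring.
(* Each of the two nonnegative terms has expectation at most 1/2, so some outcome has [Psi h <= 1],
   and this bounds every [P j h] and [E h] at once. *)
pose Psi h := (\sum_j P j h) / (2 * #|J|%:R) + E h / (2 * B).
have hm : \sum_h bernoulli_weight h * Psi h <= 1.
  have -> : \sum_h bernoulli_weight h * Psi h =
     (\sum_j \sum_h bernoulli_weight h * P j h) / (2 * #|J|%:R) +
     (\sum_h bernoulli_weight h * E h) / (2 * B).
    rewrite exchange_big /= !mulr_suml -big_split /=; apply: eq_bigr => h _.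
    by rewrite -mulr_sumr /Psi; ring.
  have -> : (\sum_j \sum_h bernoulli_weight h * P j h) = #|J|%:R.
    by under eq_bigr do rewrite EP; rewrite sumr_const.
  have -> : #|J|%:R / (2 * #|J|%:R) = 1 / 2 :> F by field; rewrite gt_eqF.
  have : (\sum_h bernoulli_weight h * E h) / (2 * B) <= 1 / 2.
    rewrite ler_pdivrMr; lra.
  lra.
have [h hh] := exists_le_expect hm.
exists h; split=> [j|].
  have h1 : P j h <= \sum_j P j h by rewrite (bigD1 j) //= lerDl sumr_ge0.
  rewrite -/(P j h) -[leRHS]mul1r -ler_pdivrMr; last lra.
  apply: le_trans hh; apply: le_trans (_ : (\sum_j P j h) / (2 * #|J|%:R) <= _).
    by rewrite ler_pM2r // invr_gt0; lra.
  by rewrite lerDl divr_ge0 //; lra.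
rewrite -/(E h) -[leRHS]mul1r -ler_pdivrMr; last lra.
apply: le_trans hh; rewrite lerDr divr_ge0 ?sumr_ge0 //; lra.
Qed.

End Rounding.

(** * Exponential inequalities *)

Lemma expD (x y : R) : exp (x + y) = exp x * exp y.
Proof. by rewrite -RplusE exp_plus. Qed.

Lemma exp_le_mono (x y : R) : x <= y -> exp x <= exp y.
Proof.
rewrite le_eqVlt => /orP[/eqP -> //|/RltP h].
by apply/RleP/Rlt_le; apply: exp_increasing.
Qed.

(** With [y = 2 * z ^ 2 - z], one has [(1 + z) * (1 + y) = 1 + z ^ 2 * (1 + 2 * z) >= 1] and
    [1 + y <= exp y]. It turns the bounds on products into bounds on sums. *)
Lemma exp_le_1D (z : R) : - (1 / 2) <= z -> exp (z - 2 * z ^+ 2) <= 1 + z.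
Proof.
move=> hz; pose y : R := 2 * z ^+ 2 - z.
have h1 : 1 + y <= exp y by apply/RleP; rewrite -!RealsE; apply: exp_ineq1_le.
have h2 : exp (z - 2 * z ^+ 2) * exp y = 1 by rewrite -expD (_ : _ + y = 0) ?expR0 // /y; ring.
have h3 : 0 < exp (z - 2 * z ^+ 2) by apply/RltP; apply: exp_pos.
have h4 : 1 <= (1 + z) * (1 + y) by rewrite /y; nra.
have : exp (z - 2 * z ^+ 2) * 1 <= exp (z - 2 * z ^+ 2) * ((1 + z) * (1 + y)).
  by rewrite ler_pM2l.
have : exp (z - 2 * z ^+ 2) * ((1 + z) * (1 + y)) <= exp (z - 2 * z ^+ 2) * ((1 + z) * exp y).
  by rewrite ler_pM2l // ler_wpM2l //; lra.
rewrite [_ * (_ * exp y)]mulrCA h2; lra.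
Qed.

Lemma exp_sum_le_prod (I : finType) (z : I -> R) : (forall i, `|z i| <= 1 / 2) ->
  exp (\sum_i (z i - 2 * z i ^+ 2)) <= \prod_i (1 + z i).
Proof.
move=> hz; rewrite (big_morph exp (id1 := 1) (op1 := *%R)) ?expR0 //; last first.
  by move=> x y; rewrite expD.
apply: ler_prod => i _; apply/andP; split; first by apply/RleP/Rlt_le; apply: exp_pos.
by apply: exp_le_1D; have := hz i; rewrite ler_norml => /andP[].
Qed.

Lemma expn4_le_exp n : (4 ^ n)%:R <= exp (2 * n%:R) :> R.
Proof.
have -> : exp (2 * n%:R) = exp 2 ^+ n by rewrite expRX mulr_natr.
rewrite natrX lerXn2r ?nnegrE //; first by apply/RleP/Rlt_le; apply: exp_pos.
have h1 : 2 <= exp 1.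
  apply/RleP; have := exp_ineq1_le 1; rewrite !RealsE => h.
  by apply: Rle_trans h; apply/RleP; lra.
by have -> : exp 2 = exp 1 * exp 1; [rewrite -expD; congr exp; lra | nra].
Qed.

(** * Rounding a symmetric weight to a graph *)

Section GraphRounding.
Variable T : finType.

Definition rank_lt (p : T * T) := (enum_rank p.1 < enum_rank p.2)%N.

Lemma sum_sym_pairs (F : realFieldType) (phi : T * T -> F) : (forall x, phi (x, x) = 0) ->
  \sum_p phi p = \sum_(p | rank_lt p) (phi p + phi (p.2, p.1)).
Proof.
move=> h0; rewrite (bigID rank_lt) big_split /=; congr (_ + _).
rewrite (reindex_inj (h := fun p : T * T => (p.2, p.1))) /=; last first.
  by move=> [x y] [x' y'] [-> ->].
rewrite (bigID (fun p => rank_lt p)) /= [X in _ + X]big1 ?addr0.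
  by apply: eq_bigl => -[x y]; rewrite /rank_lt /= -leqNgt; case: ltngtP.
move=> [x y] /andP[]; rewrite /rank_lt /= -!leqNgt => a b.
have /eqP : val (enum_rank x) == val (enum_rank y) by rewrite eqn_leq a b.
by move=> /val_inj /enum_rank_inj ->.
Qed.

(** A Chernoff bound with a union bound over all pairs [S], [U]: the exponent available is quadratic
    in [#|T|], and the number of tests is only exponential in [#|T|]. *)
Lemma graph_rounding (e : rel T) (w : T * T -> R) (eta B : R) :
  simple_graph e -> (forall p, 0 <= w p <= 1) ->
  (forall x y, w (x, y) = w (y, x)) -> (forall x, w (x, x) = 0) ->
  0 < eta <= 1 -> 32 <= eta ^+ 2 * #|T|%:R -> 0 < B ->
  \sum_p `|(e p.1 p.2)%:R - w p| <= B ->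
  exists e' : rel T, [/\ simple_graph e',
   (forall S U : {set T}, [disjoint S & U] ->
     `|\sum_(p | (p.1 \in S) && (p.2 \in U)) ((e' p.1 p.2)%:R - w p)|
        <= eta * #|T|%:R ^+ 2) &
   #|[set p : T * T | e p.1 p.2 != e' p.1 p.2]|%:R <= 2 * B].
Proof.
move=> [esym eirr] w01 wsym w0 /andP[eta0 eta1] hn B0 hB.
have n0 : 0 < #|T|%:R :> R.
  rewrite lt_def ler0n andbT; apply/negP => /eqP h; move: hn; rewrite h mulr0; lra.
pose n : R := #|T|%:R.
have n1 : 1 <= n by rewrite /n ler1n -(ltr0n R).
pose lam := eta / 4.
pose J := ({set T} * {set T} * bool)%type.
(* One coin is used per unordered pair, read at its increasing orientation. For disjoint [S] and [U]
   at most one orientation lies in [S * U], so the coefficient is 0 or a sign. *)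
pose tst (j : J) (p : T * T) : R := (-1) ^+ j.2 *
  (rank_lt p && ((p.1 \in j.1.1) && (p.2 \in j.1.2) || (p.1 \in j.1.2) && (p.2 \in j.1.1)))%:R.
pose c p : R := (rank_lt p)%:R.
have J0 : (0 < #|{: J}|)%N by apply/card_gt0P; exists (set0, set0, true).
have tst1 j p : `|tst j p| <= 1.
  by rewrite normrM normrX normrN1 expr1n mul1r normr_nat lern1 leq_b1.
have c0 p : 0 <= c p by [].
(* Each unordered pair contributes twice to the bound [B]; the factor 2 returns when changed ordered
   pairs are counted at the end. *)
have hB2 : \sum_p c p * `|(e p.1 p.2)%:R - w p| <= B / 2.
  move: hB; rewrite sum_sym_pairs; last by move=> x /=; rewrite eirr w0 subr0 normr0.
  rewrite big_split /=.
  rewrite [X in _ + X](eq_bigr (fun p => `|(e p.1 p.2)%:R - w p|)); last first.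
    by move=> [x y] _ /=; rewrite esym wsym.
  rewrite [in X in _ -> X](bigID rank_lt) /= [X in _ -> _ + X <= _]big1; last first.
    by move=> p /negbTE h; rewrite /c h mul0r.
  rewrite addr0 [X in _ -> X <= _](eq_bigr (fun p => `|(e p.1 p.2)%:R - w p|)); last first.
    by move=> p h; rewrite /c h mul1r.
  lra.
have B2 : 0 < B / 2 by lra.
have lam01 : 0 <= lam <= 1 / 2 by rewrite /lam; apply/andP; split; lra.
have [h [hP hE]] := exists_rounding w01 J0 tst1 c0 hB2 B2 lam01.
pose e' x y := (rank_lt (x, y) && h (x, y)) || (rank_lt (y, x) && h (y, x)).
have e'sym : symmetric e' by move=> x y; rewrite /e' orbC.
have e'irr : irreflexive e' by move=> x; rewrite /e' /rank_lt /= ltnn.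
have e'lt p : rank_lt p -> e' p.1 p.2 = h p.
  case: p => x y; rewrite /e' /rank_lt /= => hp; rewrite hp /=.
  by rewrite ltnNge (ltnW hp) /= orbF.
exists e'; split=> //.
- move=> S U dis.
  pose Sg : R := \sum_(p | (p.1 \in S) && (p.2 \in U)) ((e' p.1 p.2)%:R - w p).
  have hS (b : bool) : (-1) ^+ b * Sg = \sum_p tst (S, U, b) p * ((h p)%:R - w p).
    rewrite /Sg big_mkcond sum_sym_pairs; last first.
      move=> x /=; case: ifP => // /andP[xS xU].
      by have := disjointFr dis xS; rewrite xU.
    rewrite [RHS](bigID rank_lt) /= [X in _ = _ + X]big1 ?addr0; last first.
      by move=> p /negbTE hp; rewrite /tst hp mulr0 mul0r.
    rewrite mulr_sumr; apply: eq_bigr => -[x y] hp; rewrite /tst hp /=.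
    rewrite (e'sym y x) (wsym y x) -(e'lt _ hp) /= -mulrA; congr (_ * _).
    case xS : (x \in S); case yU : (y \in U); case xU : (x \in U); case yS : (y \in S);
      rewrite /= ?mul1r ?mul0r ?addr0 ?add0r //.
    all: try by have := disjointFr dis xS; rewrite xU.
    all: try by have := disjointFr dis yS; rewrite yU.
  have bound (bb : bool) : (-1) ^+ bb * Sg <= eta * n ^+ 2.
    rewrite hS.
    set s : R := \sum_p _.
    have hz p : `|lam * (tst (S, U, bb) p * ((h p)%:R - w p))| <= 1 / 2.
      have /andP[l0 l1] := lam01; have /andP[a1 a2] := w01 p.
      rewrite normrM (ger0_norm l0) -[1 / 2]mulr1 ler_pM //.
      rewrite normrM -[1]mulr1 ler_pM // ler_norml.
      by case: (h p) => /=; apply/andP; split; lra.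
    have h1 := exp_sum_le_prod hz.
    have h2 := le_trans h1 (hP (S, U, bb)).
    have h3 : 2 * #|{: J}|%:R <= exp (4 * n).
      have -> : 2 * #|{: J}|%:R = (4 ^ (#|T|).+1)%:R :> R.
        rewrite !card_prod card_bool -!cardsT -!powersetT !card_powerset !cardsT -!natrM; congr (_%:R).
        by rewrite expnS -[4%N]/(2 * 2)%N expnMn; ring.
      apply: le_trans (expn4_le_exp _) _; apply: exp_le_mono.
      by rewrite -natr1 -/n; lra.
    have h4 : lam * s - 2 * lam ^+ 2 * n ^+ 2 <= 4 * n.
      have h5 : lam * s - 2 * lam ^+ 2 * n ^+ 2 <=
         \sum_p (lam * (tst (S, U, bb) p * ((h p)%:R - w p))
                - 2 * (lam * (tst (S, U, bb) p * ((h p)%:R - w p))) ^+ 2).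
        rewrite sumrB -mulr_sumr -/s lerB // /n -(@card_pairs R T).
        rewrite mulr_natr -sumr_const; apply: ler_sum => p _.
        have /andP[a1 a2] := w01 p.
        rewrite exprMn mulrA -[leRHS]mulr1 (ler_wpM2l (mulr_ge0 (ler0n _ 2) (sqr_ge0 lam))) //.
        rewrite -real_normK ?num_real // exprn_ile1 //.
        rewrite normrM -[1]mulr1 ler_pM // ler_norml.
        by case: (h p) => /=; apply/andP; split; lra.
      apply: le_trans h5 _; rewrite leNgt; apply/negP => /RltP /exp_increasing /RltP.
      by have := le_trans h2 h3; move=> hh /(le_lt_trans hh); rewrite ltxx.
    (* With [lam = eta / 4] this reads [s <= eta / 2 * n ^ 2 + 16 * n / eta], and
       [32 <= eta ^ 2 * n] absorbs the last term. *)
    move: h4; rewrite /lam => h4.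
    have h6 : s <= eta / 2 * n ^+ 2 + 16 * n / eta.
      rewrite -(ler_pM2l eta0).
      have -> : eta * (eta / 2 * n ^+ 2 + 16 * n / eta) = eta ^+ 2 / 2 * n ^+ 2 + 16 * n.
        by field; rewrite gt_eqF.
      lra.
    apply: le_trans h6 _.
    have : 16 * n / eta <= eta / 2 * n ^+ 2.
      rewrite ler_pdivrMr //; have := ler_wpM2r (ltW n0) hn; rewrite -/n; nra.
    lra.
  rewrite ler_norml; apply/andP; split.
    by have := bound true; rewrite expr1 mulN1r -/Sg -/n; lra.
  by have := bound false; rewrite expr0 mul1r.
have -> : #|[set p : T * T | e p.1 p.2 != e' p.1 p.2]|%:R =
    \sum_p (e p.1 p.2 != e' p.1 p.2)%:R :> R.
  rewrite -sum1_card natr_sum big_mkcond; apply: eq_bigr => p _.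
  by rewrite inE; case: (_ != _).
rewrite sum_sym_pairs; last by move=> x /=; rewrite eirr e'irr.
apply: le_trans (_ : 2 * (2 * (B / 2)) <= _); last by lra.
apply: le_trans (ler_wpM2l _ hE); last by [].
rewrite mulr_sumr [leRHS](bigID rank_lt) /= -[leLHS]addr0; apply: lerD.
  apply: ler_sum => -[x y] hp; rewrite /c hp /= (esym y) (e'sym y) -(e'lt _ hp) /=.
  by rewrite eq_sym mul1r; lra.
by apply: sumr_ge0 => p _; rewrite !mulr_ge0.
Qed.

End GraphRounding.

(** * The divergence of [x ln x] *)

Lemma ln_le_subr1 (z : R) : 0 < z -> ln z <= z - 1.
Proof.
move=> /RltP z0; have /RleP := exp_ineq1_le (ln z); rewrite exp_ln // !RealsE; lra.
Qed.

Lemma lnM (x y : R) : 0 < x -> 0 < y -> ln (x * y) = ln x + ln y.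
Proof. by move=> /RltP h1 /RltP h2; rewrite -RmultE ln_mult. Qed.

Definition xlnx (x : R) : R := x * ln x.

Lemma xlnx_le0 (x : R) : 0 <= x <= 1 -> xlnx x <= 0.
Proof.
move=> /andP[]; rewrite le_eqVlt => /orP[/eqP <- _|x0 x1]; first by rewrite /xlnx mul0r.
by have := ln_le_subr1 x0; rewrite /xlnx; nra.
Qed.

(* The Bregman divergence of [x ln x] dominates the squared Hellinger distance
   [(sqrt a - sqrt b)^2], by [ln z <= z - 1] at [z = sqrt b / sqrt a]. *)
Lemma sqr_le_divergence (a b : R) : 0 <= a -> 0 <= b -> (b = 0 -> a = 0) ->
  (a - b) ^+ 2 <= 2 * (a + b) * (xlnx a - xlnx b - (ln b + 1) * (a - b)).
Proof.
rewrite /xlnx => a0; rewrite le_eqVlt => /orP[/eqP b0 h|b0 _].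
  by have a1 := h (esym b0); rewrite -b0 a1 subrr addr0 !mulr0 mul0r expr2 mulr0.
move: a0; rewrite le_eqVlt => /orP[/eqP <-|a0]; first by rewrite !mul0r; nra.
have [x x0 ->] : exists2 x : R, 0 < x & a = x * x.
  by exists (Num.sqrt a); rewrite ?sqrtr_gt0 // -expr2 sqr_sqrtr // ltW.
have [y y0 ->] : exists2 y : R, 0 < y & b = y * y.
  by exists (Num.sqrt b); rewrite ?sqrtr_gt0 // -expr2 sqr_sqrtr // ltW.
rewrite !lnM //; set E := _ - _ - _.
have hl : x * (ln y - ln x) <= y - x.
  have := ln_le_subr1 (divr_gt0 y0 x0).
  have -> : ln (y / x) = ln y - ln x.
    by apply/eqP; rewrite eq_sym subr_eq -lnM ?divr_gt0 // divfK // gt_eqF.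
  by rewrite lerBrDr ler_pdivlMr //; nra.
have hE : (x - y) ^+ 2 <= E.
  have := ler_wpM2l (ltW x0) hl; rewrite /E; nra.
have h2 : (x * x - y * y) ^+ 2 <= 2 * (x * x + y * y) * (x - y) ^+ 2.
  have : 0 <= ((x - y) * (x - y)) ^+ 2 by exact: sqr_ge0.
  by move=> h; rewrite -subr_ge0; apply: le_trans h _; rewrite le_eqVlt; apply/orP; left;
    apply/eqP; ring.
apply: le_trans h2 _; rewrite ler_wpM2l //.
by have := mulr_gt0 x0 x0; have := mulr_gt0 y0 y0; lra.
Qed.

(** The geometric mean bound [sqrt (2 * (a + b) * E)] for the difference, [E] being the divergence,
    is split by the inequality of means with weight [lam]. *)
Lemma normB_le_divergence (a b lam : R) : 0 <= a -> 0 <= b -> (b = 0 -> a = 0) -> 0 < lam ->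
  `|a - b| <= lam * (a + b) + (xlnx a - xlnx b - (ln b + 1) * (a - b)) / (2 * lam).
Proof.
move=> a0 b0 h l0; have := sqr_le_divergence a0 b0 h; set E := _ - _ - _ => hE.
have [s0|s0] := ltP 0 (a + b); last first.
  have b1 : b = 0 by apply/eqP; rewrite eq_le b0 andbT; lra.
  by rewrite /E b1 (h b1) !(subrr, addr0, mulr0, mul0r, normr0).
rewrite -(ler_pM2r (_ : 0 < 2 * lam)); last by lra.
have -> : (lam * (a + b) + E / (2 * lam)) * (2 * lam) = lam * (a + b) * (2 * lam) + E.
  by field; rewrite gt_eqF.
rewrite -(ler_pM2r (_ : 0 < 2 * (a + b))); last by lra.
have : 0 <= (`|a - b| - 2 * lam * (a + b)) ^+ 2 by exact: sqr_ge0.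
have : `|a - b| ^+ 2 = (a - b) ^+ 2 by rewrite real_normK ?num_real.
move: hE; move: (`|a - b|) ((a - b) ^+ 2) => u v hE huv hu.
have : 0 <= u ^+ 2 - 4 * lam * u * (a + b) + 4 * (lam * (a + b)) ^+ 2.
  by apply: le_trans hu _; rewrite le_eqVlt; apply/orP; left; apply/eqP; ring.
rewrite huv; set s := a + b in hE s0 *.
have -> : u * (2 * lam) * (2 * s) = 4 * lam * u * s by ring.
have -> : (lam * s * (2 * lam) + E) * (2 * s) = 4 * (lam * s) ^+ 2 + 2 * s * E by ring.
lra.
Qed.

(** * Entropy of block averages *)

Section Entropy.
Variables (X : finType) (g : X -> R).
Hypothesis g0 : forall x, 0 <= g x.

Definition entropy (L : eqType) (rho : X -> L) : R := \sum_x xlnx (blockmean rho g x).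

Lemma sum_blockmean (L : eqType) (rho : X -> L) : \sum_x blockmean rho g x = \sum_x g x.
Proof.
have := @blockmean_proj _ _ _ rho g (fun=> 1) (fun _ _ _ => erefl).
by under eq_bigr do rewrite mulr1; under [in RHS]eq_bigr do rewrite mulr1.
Qed.

(** The added linear term sums to zero: its coefficient is [rho]-blockwise, hence orthogonal to the
    increment. The difference thus becomes a sum of pointwise divergences. *)
Lemma entropy_diff (L L' : eqType) (rho' : X -> L') (rho : X -> L) : finer rho' rho ->
  entropy rho' - entropy rho =
  \sum_x (xlnx (blockmean rho' g x) - xlnx (blockmean rho g x) -
    (ln (blockmean rho g x) + 1) * (blockmean rho' g x - blockmean rho g x)).
Proof.
move=> h; rewrite !sumrB [X in _ = _ - X](_ : _ = 0) ?subr0 //.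
under eq_bigr do rewrite mulrC.
by apply: blockmean_diff => // x y e; rewrite (blockmean_blockwise _ e).
Qed.

Lemma entropy_finer (L L' : eqType) (rho' : X -> L') (rho : X -> L) : finer rho' rho ->
  entropy rho <= entropy rho'.
Proof.
move=> h; rewrite -subr_ge0 entropy_diff //; apply: sumr_ge0 => x _.
have a0 := blockmean_ge0 rho' x g0; have b0 := blockmean_ge0 rho x g0.
have := sqr_le_divergence a0 b0 (blockmean_eq0 h g0).
set a := blockmean rho' g x in a0 *; set b := blockmean rho g x in b0 *.
move=> hE; have [s0|s0] := ltP 0 (a + b).
  have : 0 <= 2 * (a + b) * (xlnx a - xlnx b - (ln b + 1) * (a - b)).
    exact: le_trans (sqr_ge0 _) hE.
  by rewrite pmulr_rge0 // mulr_gt0.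
have -> : a = 0 by apply/eqP; rewrite eq_le a0 andbT; lra.
have -> : b = 0 by apply/eqP; rewrite eq_le b0 andbT; lra.
by rewrite !subrr mulr0 subr0.
Qed.

Lemma entropy_gain (L L' : eqType) (rho' : X -> L') (rho : X -> L) (lam : R) :
  finer rho' rho -> 0 < lam ->
  \sum_x `|blockmean rho' g x - blockmean rho g x| <=
    2 * lam * (\sum_x g x) + (entropy rho' - entropy rho) / (2 * lam).
Proof.
move=> h l0; rewrite entropy_diff // mulr_suml.
have -> : 2 * lam * (\sum_x g x) = \sum_x lam * (blockmean rho' g x + blockmean rho g x).
  by rewrite -mulr_sumr big_split /= !sum_blockmean; ring.
rewrite -big_split /=; apply: ler_sum => x _; apply: normB_le_divergence => //.
- exact: blockmean_ge0.
- exact: blockmean_ge0.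
- exact: blockmean_eq0.
Qed.

Lemma entropy_le0 (L : eqType) (rho : X -> L) : (forall x, g x <= 1) -> entropy rho <= 0.
Proof.
move=> g1; rewrite -oppr_ge0 -sumrN; apply: sumr_ge0 => x _.
by rewrite oppr_ge0 xlnx_le0 // blockmean_ge0 // blockmean_le1.
Qed.

(** Every partition refines the one with a single block, whose entropy is the left side. *)
Lemma entropy_ge (L : eqType) (rho : X -> L) :
  #|X|%:R * xlnx ((\sum_x g x) / #|X|%:R) <= entropy rho.
Proof.
apply: le_trans (_ : entropy (fun=> tt) <= _); last exact: entropy_finer.
rewrite mulr_natl -sumr_const; apply: ler_sum => x _; rewrite /blockmean.
have -> : #|[pred y : X | tt == tt]| = #|X| by apply: eq_card.
by rewrite (eq_bigl predT).
Qed.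

End Entropy.

(** * Moving block densities by affine maps *)

Section Reweight.
Variable F : realFieldType.

(* The slope of the affine map that moves the mean [d'] to [d] and fixes 0 (if the
   density decreases) or 1 (if it increases). *)
Definition reweight (d d' : F) : F :=
  if d <= d' then d / d' else (1 - d) / (1 - d').

Definition reweight_tilt (d d' : F) : F :=
  if d <= d' then 1 - d / d' else (1 - d) / (1 - d') - 1.

(** The form of the third claim matters: on a block of mean [d'] the tilt term sums to zero, so the
    expected number of changes is exactly the L1 distance of the densities. *)
Lemma reweightP (d d' : F) (b : bool) (w := d + reweight d d' * (b%:R - d')) :
  0 <= d <= 1 -> 0 <= d' <= 1 ->
  [/\ 0 <= reweight d d' <= 1, 0 <= w <= 1 &
   `|b%:R - w| = reweight_tilt d d' * (b%:R - d') + `|d' - d|].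
Proof.
move=> /andP[d0 d1] /andP[e0 e1]; rewrite /w /reweight /reweight_tilt.
have [le|lt] := leP d d'.
  have hm : 0 <= d / d' <= 1.
    (* For [d' = 0] also [d = 0], and division by zero gives slope 0. *)
    rewrite divr_ge0 //=; have [->|n0] := eqVneq d' 0; first by rewrite invr0 mulr0 ler01.
    by rewrite ler_pdivrMr ?mul1r // lt_def n0.
  have e : d = d / d' * d'.
    have [z|n0] := eqVneq d' 0; last by rewrite divfK.
    by rewrite z mulr0; apply/eqP; rewrite eq_le d0 andbT -z.
  have we : d + d / d' * (b%:R - d') = d / d' * b%:R by rewrite {1}e; ring.
  rewrite we; split=> //; move: (d / d') hm e {we} => m /andP[m0 m1] e.
    by case: b {w} => /=; apply/andP; split; lra.
  rewrite (ger0_norm (_ : 0 <= d' - d)) ?subr_ge0 // e.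
  rewrite ger0_norm; last by case: b {w} => /=; lra.
  ring.
have f0 : 0 < 1 - d' by lra.
have hm : 0 <= (1 - d) / (1 - d') <= 1.
  apply/andP; split; first by rewrite divr_ge0 ?subr_ge0.
  by rewrite ler_pdivrMr // mul1r; lra.
have e : 1 - d = (1 - d) / (1 - d') * (1 - d') by rewrite divfK ?gt_eqF.
move: ((1 - d) / (1 - d')) hm e => m /andP[m0 m1] e.
have we : d + m * (b%:R - d') = 1 - m * (1 - b%:R) by lra.
rewrite we m0 m1; split=> //.
  by case: b {w we} => /=; apply/andP; split; lra.
rewrite (ler0_norm (_ : d' - d <= 0)) ?subr_le0 ?ltW //.
rewrite ler0_norm; last by case: b {w we} => /=; lra.
lra.
Qed.

End Reweight.

(** * From small discrepancy to regularity after editing *)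

Definition adj (T : finType) (e : rel T) (p : T * T) : R := (e p.1 p.2)%:R.

Lemma eAB_sum (T : finType) (e : rel T) (A B : {set T}) :
  (eAB e A B)%:R = \sum_(p | (p.1 \in A) && (p.2 \in B)) adj e p :> R.
Proof.
rewrite /eAB -sum1_card natr_sum big_mkcond [RHS]big_mkcond; apply: eq_bigr => p _.
by rewrite inE /adj; case: (p.1 \in A) => //=; case: (p.2 \in B) => //=; case: (e p.1 p.2).
Qed.

Lemma pairmean_sym (F : realFieldType) (T : finType) (g : T * T -> F) (pi : T -> nat) :
  (forall x y, g (x, y) = g (y, x)) ->
  forall x y, pairmean g pi (x, y) = pairmean g pi (y, x).
Proof.
move=> gs x y; have swap_inj : injective (fun p : T * T => (p.2, p.1)).
  by move=> [a b] [c d] [-> ->].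
have sE (p q : T * T) : (pairlabel pi (p.2, p.1) == pairlabel pi (q.2, q.1)) =
    (pairlabel pi p == pairlabel pi q).
  by rewrite /pairlabel /= !xpair_eqE andbC.
rewrite /pairmean /blockmean; congr (_ / _%:R).
  rewrite (reindex_inj swap_inj) /=; apply: eq_big => [p|[a b] _]; last exact: gs.
  by rewrite -(sE p (y, x)).
rewrite -!sum1_card (reindex_inj swap_inj); apply: eq_bigl => p.
by rewrite !inE -(sE p (y, x)).
Qed.

(** Since [#|T| <= 2 * k * m], the error is at most [8 * eps * k ^ 2 <= f ^ 3 / 2] times
    [#|A| * #|B|]. Two factors [f] pay for passing to subsets, so every relevant density is within
    [f / 2] of [d]. *)
Lemma eps_regular_of_discrepancy (T : finType) (e : rel T) (A B : {set T}) (f eps d : R)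
    (k m : nat) :
  0 < f <= 1 -> (0 < m)%N -> (m <= #|A|)%N -> (m <= #|B|)%N -> (#|T| <= 2 * k * m)%N ->
  0 <= eps -> 16 * eps * k%:R ^+ 2 <= f ^+ 3 ->
  (forall A' B' : {set T}, A' \subset A -> B' \subset B ->
    `|(eAB e A' B')%:R - d * (#|A'|%:R * #|B'|%:R)| <= 2 * eps * #|T|%:R ^+ 2) ->
  eps_regular e f A B.
Proof.
move=> /andP[f0 f1] m0 mA mB hn eps0 hf hd.
have m0' : 0 < m%:R :> R by rewrite ltr0n.
have mA' : m%:R <= #|A|%:R :> R by rewrite ler_nat.
have mB' : m%:R <= #|B|%:R :> R by rewrite ler_nat.
have A0 : 0 < #|A|%:R :> R by lra.
have B0 : 0 < #|B|%:R :> R by lra.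
have AB0 : 0 < #|A|%:R * #|B|%:R :> R by apply: mulr_gt0.
have hsmall : 2 * eps * #|T|%:R ^+ 2 <= f ^+ 3 / 2 * (#|A|%:R * #|B|%:R).
  have h1 : #|T|%:R ^+ 2 <= 4 * k%:R ^+ 2 * (#|A|%:R * #|B|%:R) :> R.
    apply: le_trans (_ : (2 * k%:R * m%:R) ^+ 2 <= _).
      by rewrite lerXn2r ?nnegrE ?mulr_ge0 // -!natrM ler_nat.
    have -> : (2 * k%:R * m%:R) ^+ 2 = 4 * k%:R ^+ 2 * (m%:R * m%:R) :> R by ring.
    by rewrite ler_wpM2l ?mulr_ge0 ?sqr_ge0 // ler_pM // ltW.
  have := ler_wpM2l (mulr_ge0 (ler0n _ 2) eps0) h1; have := ler_wpM2r (ltW AB0) hf; lra.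
have key (A' B' : {set T}) : A' \subset A -> B' \subset B ->
    f * #|A|%:R <= #|A'|%:R -> f * #|B|%:R <= #|B'|%:R -> `|dens e A' B' - d| <= f / 2.
  move=> sA sB hA hB.
  have fA : 0 < f * #|A|%:R by apply: mulr_gt0.
  have fB : 0 < f * #|B|%:R by apply: mulr_gt0.
  have A'0 : 0 < #|A'|%:R :> R by apply: lt_le_trans hA.
  have B'0 : 0 < #|B'|%:R :> R by apply: lt_le_trans hB.
  have AB'0 : 0 < #|A'|%:R * #|B'|%:R :> R by apply: mulr_gt0.
  have -> : dens e A' B' - d =
      ((eAB e A' B')%:R - d * (#|A'|%:R * #|B'|%:R)) / (#|A'|%:R * #|B'|%:R).
    rewrite /dens !INRE !RealsE; field.
    by rewrite !gt_eqF.
  rewrite normrM normfV (gtr0_norm AB'0) ler_pdivrMr //.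
  apply: le_trans (hd _ _ sA sB) _; apply: le_trans hsmall _.
  have -> : f ^+ 3 / 2 * (#|A|%:R * #|B|%:R) = f / 2 * ((f * #|A|%:R) * (f * #|B|%:R)).
    ring.
  by apply: ler_wpM2l; [lra | apply: ler_pM => //; apply: ltW].
move=> A' B' sA sB; rewrite !INRE !RealsE => /Rge_le/RleP hA /Rge_le/RleP hB.
apply/RleP.
have h1 := key _ _ sA sB hA hB.
have h2 : `|dens e A B - d| <= f / 2.
  by apply: key => //; rewrite -[leRHS]mul1r ler_wpM2r.
have -> : dens e A B - dens e A' B' = (dens e A B - d) - (dens e A' B' - d) by ring.
apply: le_trans (ler_normB _ _) _; lra.
Qed.

Section RegularEdit.
Variables (T : finType) (e : rel T).
Hypothesis eG : simple_graph e.

Lemma adj01 p : 0 <= adj e p <= 1.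
Proof. by rewrite /adj; case: (e _ _); rewrite ?lexx ?ler01. Qed.

Lemma regular_edit (f eps B : R) (k m : nat) (pi pi' : T -> nat) :
  equilabel k m pi -> (0 < m)%N -> finer pi' pi -> weakly_regular (adj e) eps pi' ->
  0 < eps <= 1 -> 32 <= eps ^+ 2 * #|T|%:R ->
  0 < f <= 1 -> 16 * eps * k%:R ^+ 2 <= f ^+ 3 ->
  0 < B -> \sum_p `|pairmean (adj e) pi' p - pairmean (adj e) pi p| <= B ->
  exists e' : rel T, [/\ simple_graph e',
   #|[set p : T * T | e p.1 p.2 != e' p.1 p.2]|%:R <= 2 * B &
   forall i j, (i < k)%N -> (j < k)%N -> i != j ->
     eps_regular e' f [set x | pi x == i] [set x | pi x == j]].
Proof.
move=> eq m0 fin wr eps01 hn f01 hf B0 hB; have [esym eirr] := eG.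
have eps0 : 0 < eps by case/andP: eps01.
pose G := adj e; pose mu := pairmean G pi; pose nu := pairmean G pi'.
have fin2 := pairlabel_finer fin.
have mu01 p : 0 <= mu p <= 1 by apply: pairmean01; apply: adj01.
have nu01 p : 0 <= nu p <= 1 by apply: pairmean01; apply: adj01.
have nuB : blockwise (pairlabel pi') nu := @blockmean_blockwise _ _ _ _ _.
have muB0 : blockwise (pairlabel pi) mu := @blockmean_blockwise _ _ _ _ _.
have muB : blockwise (pairlabel pi') mu := blockwise_finer fin2 muB0.
have diagB p q : pairlabel pi' p = pairlabel pi' q ->
    (pi p.1 == pi p.2) = (pi q.1 == pi q.2).
  by move=> /fin2 [-> ->].
have P p := reweightP (e p.1 p.2) (mu01 p) (nu01 p).
(* Pairs inside a class of [pi] are left alone: regularity concerns distinct classes only, and loops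
   keep weight 0. *)
pose w p := if pi p.1 == pi p.2 then G p else
   mu p + reweight (mu p) (nu p) * (G p - nu p).
have w01 p : 0 <= w p <= 1 by rewrite /w; case: ifP => _; [exact: adj01 | have [] := P p].
have Gs x y : G (x, y) = G (y, x) by rewrite /G /adj /= esym.
have wsym x y : w (x, y) = w (y, x).
  by rewrite /w /mu /nu /= eq_sym Gs (pairmean_sym pi Gs) (pairmean_sym pi' Gs).
have w0 x : w (x, x) = 0 by rewrite /w /= eqxx /G /adj /= eirr.
have hBw : \sum_p `|(e p.1 p.2)%:R - w p| <= B.
  apply: le_trans hB.
  pose tau p := if pi p.1 == pi p.2 then 0 else reweight_tilt (mu p) (nu p).
  have tauB : blockwise (pairlabel pi') tau.
    by move=> p q e1; rewrite /tau (diagB _ _ e1) (muB _ _ e1) (nuB _ _ e1).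
  have t0 : \sum_p (G p - nu p) * tau p = 0.
    under eq_bigr do rewrite mulrBl.
    by rewrite sumrB -(blockmean_proj G tauB) subrr.
  rewrite -[leRHS]add0r -[X in _ <= X + _]t0 -big_split /=; apply: ler_sum => p _.
  rewrite /w /tau; case: ifP => _; first by rewrite subrr normr0 mulr0 add0r.
  by have [_ _ ->] := P p; rewrite mulrC.
have [e' [se' hcut hed]] := graph_rounding eG w01 wsym w0 eps01 hn B0 hBw.
exists e'; split=> // i j ik jk ij.
have [h1 h2] := eq.
have /andP[mA _] := h2 _ ik; have /andP[mB _] := h2 _ jk.
have hT : (#|T| <= 2 * k * m)%N.
  have /andP[_ h] := equilabel_card eq; apply: leq_trans h _.
  by rewrite [(2 * k)%N]mulnC -mulnA leq_mul // mul2n -addnn -add1n leq_add2r.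
have [x xi] : exists x, pi x = i.
  have /card_gt0P[x] : (0 < #|[set x | pi x == i]|)%N by apply: leq_trans mA.
  by rewrite inE => /eqP <-; exists x.
have [y yj] : exists y, pi y = j.
  have /card_gt0P[y] : (0 < #|[set x | pi x == j]|)%N by apply: leq_trans mB.
  by rewrite inE => /eqP <-; exists y.
apply: (@eps_regular_of_discrepancy _ _ _ _ _ eps (mu (x, y)) k m) => //.
  exact: ltW.
move=> A' B' sA sB.
have lab p : (p.1 \in A') && (p.2 \in B') -> pi p.1 = i /\ pi p.2 = j.
  move=> /andP[/(subsetP sA) + /(subsetP sB)].
  by rewrite !inE => /eqP -> /eqP ->.
have dis : [disjoint A' & B'].
  rewrite disjoint_subset; apply/subsetP => z /(subsetP sA); rewrite !inE => /eqP zi.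
  apply/negP => /(subsetP sB); rewrite inE zi; exact/negP.
have -> : mu (x, y) * (#|A'|%:R * #|B'|%:R) =
    \sum_(p : T * T | (p.1 \in A') && (p.2 \in B')) mu p.
  rewrite -natrM -cardsX mulr_natr -sumr_const; apply: eq_big => [p|p].
    by rewrite inE.
  by rewrite inE => /lab[e1 e2]; apply: muB0; rewrite /pairlabel /= xi yj e1 e2.
rewrite eAB_sum -sumrB.
pose sg p := reweight (mu p) (nu p).
have sgB : blockwise (pairlabel pi') sg.
  by move=> p q e1; rewrite /sg (muB _ _ e1) (nuB _ _ e1).
have sg01 p : 0 <= sg p <= 1 by have [] := P p.
(* Rounding error plus reweighted fluctuation of [G] around [nu]. The second is covered by weak
   regularity with multiplier [sg], and each costs [eps * #|T| ^ 2]. *)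
have -> : \sum_(p : T * T | (p.1 \in A') && (p.2 \in B')) (adj e' p - mu p) =
  \sum_(p : T * T | (p.1 \in A') && (p.2 \in B')) ((e' p.1 p.2)%:R - w p) +
  \sum_(p : T * T | (p.1 \in A') && (p.2 \in B')) sg p * (G p - nu p).
  rewrite -big_split /=; apply: eq_bigr => p /lab[e1 e2].
  by rewrite /w e1 e2 (negbTE ij) /adj -/(sg p); ring.
apply: le_trans (ler_normD _ _) _.
have c1 := hcut _ _ dis.
suff : `|\sum_(p : T * T | (p.1 \in A') && (p.2 \in B')) sg p * (G p - nu p)| <=
   eps * #|T|%:R ^+ 2 by lra.
(* Weak regularity is one-sided; the lower bound uses the multiplier [- sg]. *)
rewrite ler_norml; apply/andP; split.
  rewrite lerNl -sumrN.
  under eq_bigr do rewrite -mulNr.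
  apply: (wr A' B' (fun p => - sg p)) => [p q e1|p]; first by rewrite (sgB _ _ e1).
  by rewrite normrN ger0_norm; case/andP: (sg01 p).
apply: wr => // p; by rewrite ger0_norm; case/andP: (sg01 p).
Qed.

End RegularEdit.

(** * Passing between labellings and set partitions *)

Section LabelPartition.
Variable T : finType.

Definition label_partition k (pi : T -> nat) : {set {set T}} :=
  [set [set x | pi x == i] | i : 'I_k].

Variables (k m : nat) (pi : T -> nat).
Hypotheses (eq_pi : equilabel k m pi) (m_gt0 : (0 < m)%N).

Let label_nonempty (i : 'I_k) : exists x, pi x = i.
Proof.
have [_ h2] := eq_pi; have /andP[h _] := h2 _ (ltn_ord i).
have /card_gt0P[x] := leq_trans m_gt0 h.
by rewrite inE => /eqP <-; exists x.
Qed.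

Lemma card_label_partition : #|label_partition k pi| = k.
Proof.
rewrite card_imset ?card_ord // => i j /setP e.
have [x xi] := label_nonempty i; apply: val_inj.
by have := e x; rewrite !inE xi eqxx => /esym/eqP.
Qed.

Lemma label_equipartition : equipartition (label_partition k pi).
Proof.
have [h1 h2] := eq_pi; split.
  apply/and3P; split.
  - rewrite eqEsubset subsetT; apply/subsetP => x _; apply/bigcupP.
    exists [set y | pi y == pi x]; last by rewrite inE.
    by apply/imsetP; exists (Ordinal (h1 x)).
  - apply/trivIsetP => _ _ /imsetP[i _ ->] /imsetP[j _ ->] ij.
    rewrite -setI_eq0; apply/eqP/setP => x; rewrite !inE; apply/negP => /andP[/eqP e1 /eqP e2].
    by move/eqP: ij; apply; apply/setP => y; rewrite !inE -e1 -e2.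
  - apply/imsetP => -[i _ /setP e]; have [x xi] := label_nonempty i.
    by have := e x; rewrite !inE xi eqxx.
move=> _ _ /imsetP[i _ ->] /imsetP[j _ ->].
have /andP[a b] := h2 _ (ltn_ord i); have /andP[c d] := h2 _ (ltn_ord j).
by apply: leq_trans b _; rewrite ltnS.
Qed.

End LabelPartition.

Section PartitionLabel.
Variables (T : finType) (P : {set {set T}}).
Hypothesis eqP0 : equipartition P.

Definition part_label x := index (pblock P x) (enum P).

Let partP : partition P [set: T]. Proof. by case: eqP0. Qed.

Let pblock_in x : pblock P x \in P.
Proof. by rewrite pblock_mem // (cover_partition partP). Qed.

Lemma part_label_inj x y : part_label x = part_label y -> pblock P x = pblock P y.
Proof.
by move=> /(congr1 (nth set0 (enum P))); rewrite !nth_index ?mem_enum.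
Qed.

Lemma part_label_equilabel : (0 < #|T|)%N ->
  exists2 m, (0 < m)%N & equilabel #|P| m part_label.
Proof.
move=> T0; have /card_gt0P[x0 _] := T0.
(* The size of a smallest part serves as [m]. *)
have [A PA hmin] := @arg_minnP _ (pblock P x0) (mem P) (fun A => #|A|) (pblock_in x0).
have [_ hsz] := eqP0; have triv := partition_trivIset partP.
exists #|A|; first by rewrite card_gt0; apply: (partition_neq0 partP).
split=> [x|i hi]; first by rewrite cardE index_mem mem_enum.
pose C := nth set0 (enum P) i.
have PC : C \in P by rewrite -mem_enum mem_nth // -cardE.
have -> : [set x | part_label x == i] = C.
  apply/setP => x; rewrite inE; apply/eqP/idP => [h|xC].
    by rewrite /C -h nth_index ?mem_enum // mem_pblock (cover_partition partP).
  by rewrite /part_label (def_pblock triv PC xC) /C index_uniq ?enum_uniq // -cardE.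
by rewrite (hmin _ PC) hsz.
Qed.

Lemma label_refines k pi : (forall x, (pi x < k)%N) ->
  (forall i, (i < k)%N -> exists x, pi x = i) ->
  finer pi part_label -> refines (label_partition k pi) P.
Proof.
move=> h1 h2 fin _ /imsetP[i _ ->]; have [x xi] := h2 _ (ltn_ord i).
exists (pblock P x) => //; apply/subsetP => y; rewrite inE -xi => /eqP /fin /part_label_inj <-.
by rewrite mem_pblock (cover_partition partP).
Qed.

End PartitionLabel.

(** * One round of refinement and its iteration *)

Lemma eps_regular_singletons (T : finType) (e : rel T) (f : R) (a b : T) : 0 < f ->
  eps_regular e f [set a] [set b].
Proof.
move=> f0 A' B' sA sB; rewrite !cards1 !INRE !RealsE mulr1 => /Rge_le/RleP hA /Rge_le/RleP hB.
have -> : A' = [set a].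
  move: sA; rewrite subset1 => /orP[/eqP -> //|/eqP e0].
  by move: hA; rewrite e0 cards0 leNgt f0.
have -> : B' = [set b].
  move: sB; rewrite subset1 => /orP[/eqP -> //|/eqP e0].
  by move: hB; rewrite e0 cards0 leNgt f0.
by rewrite subrr normr0; apply/RleP; rewrite ltW.
Qed.

Section Iteration.
Variables (f : nat -> R) (T : finType) (e : rel T) (delta : R).
Hypothesis f01 : forall n, (Rlt 0 (f n) /\ Rlt (f n) 1).
Hypothesis f_decr : forall m n, (m <= n)%N -> Rle (f n) (f m).
Hypothesis eG : simple_graph e.
Hypothesis delta0 : 0 < delta.

Let f_gt0 n : 0 < f n. Proof. by have [/RltP] := f01 n. Qed.
Let f_lt1 n : f n < 1. Proof. by have [_ /RltP] := f01 n. Qed.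

Definition degree_sum : R := \sum_p adj e p.
Hypothesis S_gt0 : 0 < degree_sum.

Definition pair_entropy (pi : T -> nat) := entropy (adj e) (pairlabel pi).

(** Changes are counted in ordered pairs and [degree_sum] is twice the number of edges, so the
    budget is [delta] times the number of edges. *)
Definition regular_after_edit (pi : T -> nat) (bound : nat) :=
  exists e' k m pi', [/\ simple_graph e',
    #|[set p : T * T | e p.1 p.2 != e' p.1 p.2]|%:R <= delta * degree_sum,
    equilabel k m pi' /\ (0 < m)%N, finer pi' pi /\ (k <= bound)%N &
    forall i j, (i < k)%N -> (j < k)%N -> i != j ->
      eps_regular e' (f k) [set x | pi' x == i] [set x | pi' x == j]].

Lemma regular_discrete pi bound : (#|T| <= bound)%N -> regular_after_edit pi bound.
Proof.
move=> hn; pose pi' (x : T) : nat := enum_rank x.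
have cls i (hi : (i < #|T|)%N) : [set x | pi' x == i] = [set enum_val (Ordinal hi)].
  apply/setP => x; rewrite !inE; apply/eqP/eqP => [h|->]; last by rewrite /pi' enum_valK.
  by rewrite -[x]enum_rankK; congr enum_val; apply: val_inj.
exists e, #|T|, 1%N, pi'; split=> //.
- rewrite (_ : [set _ | _] = set0) ?cards0 ?mulr_ge0 ?ltW //.
  by apply/setP => p; rewrite !inE eqxx.
- split=> //; split=> [x|i hi]; first exact: ltn_ord.
  by rewrite cls cards1.
- by split=> // x y /val_inj /enum_rank_inj ->.
- by move=> i j hi hj _; rewrite (cls i hi) (cls j hj); apply: eps_regular_singletons.
Qed.

Lemma regular_or_entropy k m pi : equilabel k m pi -> (0 < k)%N -> (0 < m)%N ->
  regular_after_edit pi (iter 6 (Ffun f) k) \/ regular_after_edit pi k \/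
  exists k' m' pi', [/\ equilabel k' m' pi', (0 < k')%N, (0 < m')%N,
    finer pi' pi /\ (k' <= iter 6 (Ffun f) k)%N &
    pair_entropy pi + delta ^+ 2 * degree_sum / 16 <= pair_entropy pi'].
Proof.
move=> eq k0 m0.
have := ratio_bound_tower f01 f_decr k0.
have [rk] := ratio_boundP f01 k0; set M := ratio_bound f k => /and3P[kM M2 _].
(* Matched to [eps = 1 / (16 * M ^ 3)] below: [eps * l = 32] and [N * eps ^ 2 = 4 + eps ^ 2], as
   weak regularity requires. *)
set l := (2 ^ 9 * M ^ 3)%N; set N := (2 ^ 10 * M ^ 6).+1 => hK.
have [hbig|hsmall] := leqP #|T| (2 * M * l ^ N).
  by left; apply: regular_discrete; apply: leq_trans hK.
right.
have M0 : 0 < M%:R :> R by rewrite ltr0n; apply: leq_trans M2.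
have Mn0 : (0 < M)%N by apply: leq_trans M2.
have l0 : (0 < l)%N by rewrite muln_gt0 !expn_gt0 Mn0.
have lE : l%:R = 512 * M%:R ^+ 3 :> R by rewrite /l natrM !natrX; ring.
have NE : N%:R = 1024 * M%:R ^+ 6 + 1 :> R.
  by rewrite /N -natr1 natrM !natrX; ring.
pose eps : R := (16 * M%:R ^+ 3)^-1.
have M30 : 0 < M%:R ^+ 3 :> R by rewrite exprn_gt0.
have M60 : 0 < M%:R ^+ 6 :> R by rewrite exprn_gt0.
have eps0 : 0 < eps by rewrite invr_gt0 mulr_gt0.
have heps : eps * M%:R ^+ 3 = 1 / 16 by rewrite /eps; field; rewrite gt_eqF.
have heps2 : eps ^+ 2 * M%:R ^+ 6 = 1 / 256.
  have -> : eps ^+ 2 * M%:R ^+ 6 = (eps * M%:R ^+ 3) ^+ 2 by ring.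
  by rewrite heps; field.
have hl : 24 <= eps * l%:R by rewrite lE mulrCA heps; lra.
have hN : 4 < N%:R * eps ^+ 2.
  rewrite NE mulrDl mul1r -mulrA [M%:R ^+ 6 * _]mulrC heps2.
  by have := exprn_gt0 2 eps0; lra.
have hn : (2 * k * l ^ N <= #|T|)%N.
  by apply: leq_trans (ltnW hsmall); rewrite leq_mul // leq_mul.
have [j [m' [pi' [hj eq' fin wr]]]] := weak_regularity (@adj01 T e) eq eps0 hl k0 hn hN.
have lj : (l ^ j <= l ^ N)%N by rewrite leq_pexp2l.
have k'0 : (0 < k * l ^ j)%N by rewrite muln_gt0 k0 expn_gt0 l0.
have m'0 : (0 < m')%N.
  have /andP[_ h] := equilabel_card eq'.
  have : (k * l ^ j * 2 <= k * l ^ j * m'.+1)%N.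
    by apply: leq_trans h; apply: leq_trans hn; rewrite mulnC mulnA leq_mul.
  by rewrite leq_pmul2l.
have [hD|hD] := leP (\sum_p `|pairmean (adj e) pi' p - pairmean (adj e) pi p|)
    (delta * degree_sum / 2); last first.
  right; exists (k * l ^ j)%N, m', pi'; split=> //.
    split=> //; apply: leq_trans hK; rewrite -mulnA.
    exact: leq_trans (leq_mul kM lj) (leq_pmull _ _).
  (* This weight turns half of the L1 distance [delta * degree_sum / 2] into the linear term; the
     other half forces a gain above [delta ^ 2 * degree_sum / 16]. *)
  have lam0 : 0 < delta / 8 by rewrite divr_gt0.
  have := entropy_gain (fun p => proj1 (andP (adj01 e p))) (pairlabel_finer fin) lam0.
  move=> hg; have := lt_le_trans hD hg.
  rewrite -/degree_sum -/(pair_entropy pi) -/(pair_entropy pi').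
  move: (pair_entropy pi') (pair_entropy pi) => a b h.
  have : delta * degree_sum / 4 < (a - b) / (2 * (delta / 8)) by lra.
  by rewrite ltr_pdivlMr; [lra | lra].
left.
have B0 : 0 < delta * degree_sum / 2 by have := mulr_gt0 delta0 S_gt0; lra.
have eps1 : 0 < eps <= 1.
  rewrite eps0 /= invf_le1 ?mulr_gt0 //.
  have : 1 <= M%:R ^+ 3 :> R by rewrite exprn_ege1 // ler1n.
  lra.
have hT : 32 <= eps ^+ 2 * #|T|%:R.
  have h1 : (l ^ 2 <= #|T|)%N.
    apply: leq_trans hn; apply: leq_trans (_ : l ^ N <= _)%N.
      by rewrite leq_pexp2l // /N ltnS muln_gt0 !expn_gt0 Mn0.
    by rewrite leq_pmull // muln_gt0.
  have : (l%:R ^+ 2 <= #|T|%:R :> R) by rewrite -natrX ler_nat.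
  rewrite lE => h2; apply: le_trans (ler_wpM2l (sqr_ge0 eps) h2).
  have -> : eps ^+ 2 * (512 * M%:R ^+ 3) ^+ 2 = 512 ^+ 2 * (eps ^+ 2 * M%:R ^+ 6) by ring.
  by rewrite heps2; lra.
have fk1 : 0 < f k <= 1 by rewrite f_gt0 ltW.
(* The left side is [k ^ 2 / M ^ 3 <= (k / M) ^ 3], and [k / f k <= M]. *)
have hf : 16 * eps * k%:R ^+ 2 <= f k ^+ 3.
  have h1 : k%:R <= f k * M%:R.
    move/RleP: rk; rewrite !RealsE ler_pdivrMr //; lra.
  have h2 : k%:R ^+ 3 <= (f k * M%:R) ^+ 3 by rewrite lerXn2r ?nnegrE // mulr_ge0 ?ltW.
  have h3 : k%:R ^+ 2 <= k%:R ^+ 3 :> R by rewrite ler_weXn2l // ler1n.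
  have h4 := ler_wpM2l (ltW eps0) (le_trans h3 h2).
  have e4 : eps * (f k * M%:R) ^+ 3 = f k ^+ 3 * (eps * M%:R ^+ 3) by ring.
  by rewrite e4 heps in h4; lra.
have [e' [se' hed hreg]] := regular_edit eG eq m0 fin wr eps1 hT fk1 hf B0 hD.
exists e', k, m, pi; split=> //; first by lra.
by split=> //; apply: finer_refl.
Qed.

Lemma regular_after_edit_weaken pi pi0 b b0 : finer pi pi0 -> (b <= b0)%N ->
  regular_after_edit pi b -> regular_after_edit pi0 b0.
Proof.
move=> hf hb [e' [k [m [pi' [a1 a2 a3 [a4 a5] a6]]]]]; exists e', k, m, pi'; split=> //.
by split; [exact: finer_trans a4 hf | exact: leq_trans hb].
Qed.

(** Each unsuccessful round uses one unit of the entropy deficit and 6 iterations of [Ffun]; at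
    [t = 0] the hypothesis contradicts [entropy_le0]. *)
Lemma regular_by_entropy t k m pi : equilabel k m pi -> (0 < k)%N -> (0 < m)%N ->
  - pair_entropy pi < t%:R * (delta ^+ 2 * degree_sum / 16) ->
  regular_after_edit pi (iter (6 * t) (Ffun f) k).
Proof.
elim: t k m pi => [|t IH] k m pi eq k0 m0 hE.
  have := @entropy_le0 _ (adj e) (fun p => proj1 (andP (adj01 e p))) _ (pairlabel pi)
    (fun p => proj2 (andP (adj01 e p))).
  by rewrite -/(pair_entropy pi); move: hE; rewrite mul0r; lra.
have it (c d : nat) : (d <= c)%N -> (iter d (Ffun f) k <= iter c (Ffun f) k)%N.
  by move=> h; apply: iter_Ffun_le.
case: (regular_or_entropy eq k0 m0) => [h|[h|[k' [m' [pi' [a1 a2 a3 [a4 a5] a6]]]]]].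
- by apply: regular_after_edit_weaken h => //; apply: it; lia.
- by apply: regular_after_edit_weaken h => //; apply: (it _ 0%N).
have hE' : - pair_entropy pi' < t%:R * (delta ^+ 2 * degree_sum / 16).
  by move: hE; rewrite -natr1 mulrDl mul1r; lra.
apply: regular_after_edit_weaken (IH _ _ _ a1 a2 a3 hE') => //.
by rewrite mulnS addnC iterD iter_Ffun_mono.
Qed.

End Iteration.

(** * Empty and complete graphs, and the final count of rounds *)

Lemma eps_regular_const (T : finType) (e : rel T) (f : R) (A B : {set T}) (b : bool) :
  0 < f -> A != set0 -> B != set0 ->
  (forall x y, x \in A -> y \in B -> e x y = b) -> eps_regular e f A B.
Proof.
move=> f0 A0 B0 hb.
have key (A' B' : {set T}) : A' \subset A -> B' \subset B -> A' != set0 -> B' != set0 ->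
    dens e A' B' = b%:R.
  move=> sA sB nA nB; rewrite /dens !INRE !RealsE.
  have -> : (eAB e A' B')%:R = b%:R * (#|A'|%:R * #|B'|%:R) :> R.
    rewrite eAB_sum -natrM -cardsX mulr_natr -sumr_const; apply: eq_big => [p|p].
      by rewrite inE.
    by case/andP => hA hB; rewrite /adj (hb _ _ (subsetP sA _ hA) (subsetP sB _ hB)).
  by rewrite mulfK // mulf_neq0 // pnatr_eq0 cards_eq0.
move=> A' B' sA sB; rewrite !RealsE => /Rge_le/RleP hA /Rge_le/RleP hB; apply/RleP.
have ne (C D : {set T}) : C != set0 -> f * #|C|%:R <= #|D|%:R -> D != set0.
  move=> C0 h; rewrite -cards_eq0 -(pnatr_eq0 R) gt_eqF //; apply: lt_le_trans h.
  by rewrite mulr_gt0 // ltr0n card_gt0.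
have nA := ne _ _ A0 hA; have nB := ne _ _ B0 hB.
rewrite (key A B) // (key A' B') //.
by rewrite subrr normr0 ltW.
Qed.

Section Conclusion.
Variables (T : finType) (e : rel T).
Hypothesis eG : simple_graph e.

Lemma degree_sumE : degree_sum e = (eAB e setT setT)%:R.
Proof. by rewrite eAB_sum; apply: eq_bigl => p; rewrite !inE. Qed.

Lemma nedgesE : nedges e = degree_sum e / 2.
Proof. by rewrite /nedges !RealsE degree_sumE. Qed.

Lemma densityE : density e = degree_sum e / #|T|%:R ^+ 2.
Proof.
have -> : degree_sum e = 2 * nedges e by rewrite nedgesE; field.
by rewrite /density !RealsE.
Qed.

Lemma degree_sum_le : degree_sum e <= #|T|%:R ^+ 2.
Proof.
rewrite -(card_pairs R) -sum1_card natr_sum; apply: ler_sum => p _.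
by case/andP: (adj01 e p).
Qed.

Lemma density_gt0 : 0 < density e -> 0 < #|T|%:R :> R /\ 0 < degree_sum e.
Proof.
rewrite densityE => h.
have S0 : 0 <= degree_sum e by rewrite degree_sumE.
have n0 : 0 < #|T|%:R :> R.
  rewrite lt_def ler0n andbT; apply/eqP => z; move: h.
  by rewrite z expr0n invr0 mulr0 ltxx.
by split=> //; move: h; rewrite pmulr_lgt0 // invr_gt0 exprn_gt0.
Qed.

Definition homogeneous (b : bool) : rel T := fun x y => (x != y) && b.

Lemma homogeneous_simple b : simple_graph (homogeneous b).
Proof. by split=> [x y|x]; rewrite /homogeneous ?eqxx // eq_sym. Qed.

Lemma homogeneous_regular f P b : (forall n, 0 < f n) -> equipartition P ->
  f_regular (homogeneous b) f P.
Proof.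
move=> f0 [part _] A B PA PB AB.
have ne C : C \in P -> C != set0.
  by move=> PC; apply/eqP => C0; have /and3P[_ _] := part; rewrite -C0 PC.
apply: (@eps_regular_const _ _ _ _ _ b); rewrite ?ne // => x y xA yB.
rewrite /homogeneous; case: eqP => // xy.
have /disjointFr := trivIsetP (partition_trivIset part) _ _ PA PB AB.
by move=> /(_ _ xA); rewrite xy yB.
Qed.

Lemma edit_homogeneous b : #|[set p : T * T | e p.1 p.2 != homogeneous b p.1 p.2]|%:R <=
  (if b then #|T|%:R ^+ 2 - degree_sum e else degree_sum e).
Proof.
have [esym eirr] := eG.
have -> : (if b then #|T|%:R ^+ 2 - degree_sum e else degree_sum e) =
    \sum_p (if b then 1 - adj e p else adj e p).
  case: b => //; rewrite sumrB; congr (_ - _).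
  by rewrite -(card_pairs R) -sum1_card natr_sum.
rewrite -sum1_card natr_sum big_mkcond; apply: ler_sum => -[x y] _.
rewrite inE /homogeneous /adj /=; case: (eqVneq x y) => [->|_].
  by rewrite eirr; case: b; rewrite ?subr0.
by case: b; case: (e x y); rewrite /= ?subrr ?subr0.
Qed.

End Conclusion.

Lemma edit_distE (T : finType) (e e' : rel T) :
  edit_dist e e' = #|[set p : T * T | e p.1 p.2 != e' p.1 p.2]|%:R / 2.
Proof. by rewrite /edit_dist !RealsE. Qed.

Lemma entropy_budget (F : realFieldType) (L t d S E n p : F) :
  S = p * n -> n * (p * - (L * d)) <= E -> 0 < d -> 0 < S -> 16 * L < t ->
  - E < t * (d * S / 16).
Proof.
move=> hS hE d0 S0 ht.
have hdS : 0 < d * S / 16 by rewrite divr_gt0 ?mulr_gt0.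
apply: (@le_lt_trans _ _ (16 * L * (d * S / 16))); last by rewrite ltr_pM2r.
by rewrite hS; lra.
Qed.

Lemma sparse_regular_approximation (delta : R) (f : nat -> R) (T : finType) (e : rel T)
    (P0 : {set {set T}}) :
  0 < delta -> (forall n, (Rlt 0 (f n) /\ Rlt (f n) 1)) ->
  (forall m n, (m <= n)%N -> Rle (f n) (f m)) ->
  simple_graph e -> 0 < density e -> equipartition P0 ->
  exists (e' : rel T) (P : {set {set T}}) (h : nat),
    simple_graph e' /\ edit_dist e e' <= delta * nedges e /\
    equipartition P /\ refines P P0 /\ f_regular e' f P /\
    h%:R <= 108 * ln (1 / density e) / delta ^+ 2 /\
    (#|P| <= iter h (Ffun f) #|P0|)%N.
Proof.
move=> d0 f01 f_decr eG p0 eqP0; have [n0 S0] := density_gt0 p0.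
have f_gt0 n : 0 < f n by have [/RltP] := f01 n.
have n20 : 0 < #|T|%:R ^+ 2 :> R by rewrite exprn_gt0.
move: (densityE e) p0; move: (density e) => p pE p0.
have p1 : p <= 1 by rewrite pE ler_pdivrMr // mul1r degree_sum_le.
have SE : degree_sum e = p * #|T|%:R ^+ 2 by rewrite pE divfK // gt_eqF.
have lnV : ln (1 / p) + ln p = 0.
  by rewrite -lnM ?divr_gt0 // divfK ?gt_eqF //; apply: ln_1.
have lnp : 1 - p <= ln (1 / p) by have := ln_le_subr1 p0; lra.
have d20 : 0 < delta ^+ 2 by rewrite exprn_gt0.
have trivial b : (if b then #|T|%:R ^+ 2 - degree_sum e else degree_sum e)
     <= delta * degree_sum e ->
   exists (e' : rel T) (P : {set {set T}}) (h : nat),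
    simple_graph e' /\ edit_dist e e' <= delta * nedges e /\
    equipartition P /\ refines P P0 /\ f_regular e' f P /\
    h%:R <= 108 * ln (1 / p) / delta ^+ 2 /\
    (#|P| <= iter h (Ffun f) #|P0|)%N.
  move=> hb; exists (homogeneous b), P0, 0%N.
  split; first exact: homogeneous_simple.
  split; first by have := edit_homogeneous eG b; rewrite edit_distE nedgesE; lra.
  split=> //; split; first by move=> A PA; exists A.
  split; first exact: homogeneous_regular.
  have lp0 : 0 <= ln (1 / p) by lra.
  by split=> //; apply: divr_ge0; [apply: mulr_ge0 | exact: ltW].
(* Here all edges may be deleted; in the next case all missing edges may be added. Both use
   [h = 0]. *)
have [d1|d1] := leP 1 delta.
  by apply: (trivial false); rewrite -[leLHS]mul1r ler_wpM2r // ltW.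
have [hc|hc] := leP (#|T|%:R ^+ 2 - degree_sum e) (delta * degree_sum e).
  exact: (trivial true).
have hp : p * (1 + delta) < 1.
  by rewrite -(ltr_pM2r n20) mul1r mulrAC -SE; lra.
(* From [ln (1 / p) >= 1 - p > delta / (1 + delta)] and [delta < 1]. It yields [L >= 1/2], which
   absorbs the rounding of [t]: [6 * t <= 6 * (16 * L + 1) <= 108 * L]. *)
have hL : delta / 2 <= ln (1 / p) by nra.
set L := ln (1 / p) / delta ^+ 2.
have L2 : 1 / 2 <= L by rewrite ler_pdivlMr //; nra.
have T0 : (0 < #|T|)%N by rewrite -(ltr0n R).
have [m m0 eq0] := part_label_equilabel eqP0 T0.
have k0 : (0 < #|P0|)%N.
  by have /andP[_] := equilabel_card eq0; case: (#|P0|) => //; rewrite mul0n leqNgt T0.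
have [t t1 t2] : exists2 t : nat, 16 * L < t%:R & t%:R <= 16 * L + 1.
  have /truncn_itv /andP[h1 h2] : 0 <= 16 * L by lra.
  by exists (Num.truncn (16 * L)).+1; rewrite // -natr1 lerD2r.
have hent : - pair_entropy e (part_label P0) < t%:R * (delta ^+ 2 * degree_sum e / 16).
  have := entropy_ge (fun p => proj1 (andP (adj01 e p))) (pairlabel (part_label P0)).
  rewrite -/(degree_sum e) -/(pair_entropy e _) card_pairs -pE /xlnx => h.
  have lnE : ln p = - (L * delta ^+ 2) by rewrite /L divfK ?gt_eqF //; lra.
  rewrite lnE in h; exact: entropy_budget SE h d20 S0 t1.
have [e' [k [m' [pi [se' hed [eqk m'0] [fin hk] hreg]]]]] :=
  regular_by_entropy f01 f_decr eG d0 S0 eq0 k0 m0 hent.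
exists e', (label_partition k pi), (6 * t)%N; split=> //.
split; first by rewrite edit_distE nedgesE; lra.
split; first exact: label_equipartition eqk m'0.
have [h1 h2] := eqk.
split.
  apply: label_refines fin => // i ik.
  have /andP[h _] := h2 _ ik; have /card_gt0P[x] := leq_trans m'0 h.
  by rewrite inE => /eqP <-; exists x.
have ck := card_label_partition eqk m'0.
split.
  move=> _ _ /imsetP[i _ ->] /imsetP[j _ ->] ij; rewrite ck; apply: hreg => //.
  by apply: contraNneq ij => ->.
split; last by rewrite ck.
by rewrite natrM -mulrA -/L; lra.
Qed.

Delimit Scope R_scope with R.

Theorem theorem3p8 :
  exists c : R, (0 < c)%R /\
  forall (delta : R) (f : nat -> R),
    (0 < delta)%R ->
    (forall n, 0 < f n < 1)%R ->
    (forall m n, (m <= n)%N -> (f n <= f m)%R) ->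
  forall (T : finType) (e : rel T) (P0 : {set {set T}}),
    simple_graph e ->
    (0 < density e)%R ->
    equipartition P0 ->
  exists (e' : rel T) (P : {set {set T}}) (h : nat),
    simple_graph e' /\
    (edit_dist e e' <= delta * nedges e)%R /\
    equipartition P /\ refines P P0 /\ f_regular e' f P /\
    (INR h <= c * ln (1 / density e) / delta ^ 2)%R /\
    (#|P| <= iter h (Ffun f) #|P0|)%N.
Proof.
exists (108 : R); split; first by apply/RltP.
move=> delta f /RltP d0 f01 fd T e P0 eG /RltP p0 eqP0.
have [e' [P [h [h1 [/RleP h2 [h3 [h4 [h5 [/RleP h6 h7]]]]]]]]] :=
  sparse_regular_approximation d0 f01 fd eG p0 eqP0.
exists e', P, h; do 5!(split=> //); split=> //.
by rewrite !RealsE.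
Qed.
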